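(* Let $A=\sum_{\alpha\in\mathbb{N}_0^n}\frac{a_\alpha}{\alpha!}\cdot\partial^\alpha$ with $a_\alpha\in\mathbb{R}[x_1,\dots,x_n]_{\leq|\alpha|}$ for all $\alpha\in\mathbb{N}_0^n$ (in particular $a_0\in\mathbb{R}$ is a constant). Then the following are equivalent: (i) $e^{tA}$ is a positivity preserver for all $t\geq 0$, i.e. $e^{tA}\mathrm{Pos}(\mathbb{R}^n)\subseteq\mathrm{Pos}(\mathbb{R}^n)$ for all $t\ge 0$; (ii) for every $y\in\mathbb{R}^n$ there exist a real symmetric matrix $\Sigma(y)=(\sigma_{i,j}(y))_{i,j=1}^n\succeq 0$, a vector $b(y)=(b_1(y),\dots,b_n(y))^T\in\mathbb{R}^n$, and a measure $\nu_y$ on $\mathbb{R}^n$ with $\int_{\|x\|_2\geq 1}|x_i|\,\mathrm{d}\nu_y(x)<\infty$ for $i=1,\dots,n$ and $\int_{\mathbb{R}^n}|x^\alpha|\,\mathrm{d}\nu_y(x)<\infty$ for all $\alpha\in\mathbb{N}_0^n$ with $|\alpha|\geq 2$, such that $a_{e_i}(y)=b_i(y)+\int_{\|x\|_2\geq 1}x_i\,\mathrm{d}\nu_y(x)$ for $i=1,\dots,n$, $a_{e_i+e_j}(y)=\sigma_{i,j}(y)+\int_{\mathbb{R}^n}x^{e_i+e_j}\,\mathrm{d}\nu_y(x)$ for all $i,j=1,\dots,n$, and $a_\alpha(y)=\int_{\mathbb{R}^n}x^\alpha\,\mathrm{d}\nu_y(x)$ for all $\alpha\in\mathbb{N}_0^n$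 with $|\alpha|\geq 3$.
   Context: $\mathrm{Pos}(\mathbb{R}^n)$ is the set of polynomials in $\mathbb{R}[x_1,\dots,x_n]$ that are non-negative on $\mathbb{R}^n$. Since each $a_\alpha$ has degree at most $|\alpha|$, $A$ maps each space $\mathbb{R}[x_1,\dots,x_n]_{\leq d}$ of polynomials of degree $\le d$ into itself, so $e^{tA}=\sum_{k\ge0}\frac{t^kA^k}{k!}$ is well-defined on $\mathbb{R}[x_1,\dots,x_n]$ (computed on each finite-dimensional space $\mathbb{R}[x_1,\dots,x_n]_{\le d}$). $e_i$ denotes the $i$-th unit vector in $\mathbb{N}_0^n$, $\alpha!=\alpha_1!\cdots\alpha_n!$. *)

(* Defs.v *)
From HB Require Import structures.
From mathcomp Require Import all_boot all_order all_algebra.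
From mathcomp Require Import mpoly.
From mathcomp Require Import all_classical all_reals all_analysis.
Set Implicit Arguments. Unset Strict Implicit. Unset Printing Implicit Defensive.
Import Order.TTheory GRing.Theory Num.Theory numFieldNormedType.Exports.
Local Open Scope ring_scope.

Section Defs.
Context {R : realType} {n : nat}.

Definition mfact (al : 'X_{1..n}) : nat := (\prod_(i < n) (al i)`!)%N.

Definition Pos (p : {mpoly R[n]}) : Prop := forall x : 'I_n -> R, 0 <= p.@[x].

(* The operator A = sum_alpha a_alpha / alpha! * d^alpha, applied to p.
   Only alpha with |alpha| <= deg p (i.e. mdeg alpha < msize p) contribute,
   since d^alpha p = 0 otherwise; so the (formally infinite) sum is the
   finite sum below. *)
Definition diffop (a : 'X_{1..n} -> {mpoly R[n]}) (p : {mpoly R[n]})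
  : {mpoly R[n]} :=
  \sum_(al : 'X_{1..n < msize p})
     ((mfact al)%:R^-1 : R) *: (a al * p^`M[al]).

(* e^{tA} p : coefficientwise the sum of the series sum_k t^k/k! (A^k p).
   Since A maps polynomials of degree <= deg p into themselves, only the
   monomials of degree <= deg p can have nonzero coefficient. *)
Definition expA (a : 'X_{1..n} -> {mpoly R[n]}) (t : R) (p : {mpoly R[n]})
  : {mpoly R[n]} :=
  \sum_(m : 'X_{1..n < msize p})
     limn (series (fun k : nat =>
        t ^+ k / (k`!)%:R * (iter k (diffop a) p)@_m)) *: 'X_[m].

Definition xpow (al : 'X_{1..n}) (x : n.-tuple R) : R :=
  \prod_(i < n) (tnth x i) ^+ (al i).

Definition outer_ball : set (n.-tuple R) :=
  [set x | 1 <= \sum_(i < n) (tnth x i) ^+ 2].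

Definition psd_sym (S : 'M[R]_n) : Prop :=
  S^T = S /\ forall v : 'cV[R]_n, 0 <= (v^T *m S *m v) 0 0.

End Defs.

(* Main.v *)
Require Import Defs.
From HB Require Import structures.
From mathcomp Require Import all_boot all_order all_algebra.
From mathcomp Require Import ssrcomplements mpoly.
From mathcomp Require Import all_classical all_reals all_analysis.
From mathcomp Require Import measurable_realfun ring lra.
Set Implicit Arguments. Unset Strict Implicit. Unset Printing Implicit Defensive.
Import Order.TTheory GRing.Theory Num.Theory numFieldNormedType.Exports.
Local Open Scope ring_scope.

(** Freezing the coefficients at [y] turns [A] into the functional
    [q |-> (A (q (. - y))) y = \sum_al a_al(y) q_al]. Both conditions of the
    theorem are equivalent to: for every [y] this functional is nonnegative on
    the nonnegative polynomials vanishing at [0] ("conditional positivity").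

    Preserver => conditionally positive: differentiate [e^{tA} p] at [t = 0] in
    a zero of [p].

    Conditionally positive => preserver: a maximum principle. If [e^{tA} p]
    became negative, then, after adding [eps e^{Ct} (1 + |x|^2)^k] to make it
    coercive, a minimum over space and time would contradict the sign of [A] at
    a spatial minimum.

    Levy data => conditionally positive: a nonnegative polynomial vanishing at
    [0] has no linear part and a positive semidefinite quadratic part.

    Conditionally positive => Levy data: extend the functional by Hahn-Banach
    to all functions dominated by [|x|^2 (1 + |x|^2)^k] and divide by [|x|^2].
    In the coordinates [x / |x|, 1 / (1 + |x|)] the result is a positive
    functional on bounded functions on a cube; cutting the cube dyadically and
    mapping an interval of length its mass onto the nested dyadic cells
    represents it by a measure. Its part at radius [0] gives [Sigma], and the
    rest, with density [|x|^-2], gives [nu]. *)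


(** * Translation, Taylor coefficients and the operator *)

(** The condition at [y] tests only polynomials vanishing at [0], and a nonnegative one has no
    linear part: [a_0] and the first-order coefficients stay unconstrained. The former is absorbed
    in the maximum principle by an exponential factor in time, the latter by the free vector [b].

    The extension goes to all dominated functions, not just continuous ones, because it is applied
    to indicators of dyadic cells. There it is only finitely additive; countable additivity comes
    from Lebesgue measure on an interval, and the two sides agree on Lipschitz functions, which are
    uniform limits of functions of finitely many binary digits. This replaces the Riesz
    representation theorem.

    The two ends of the radius need care. Radius [0] keeps its directions, so that second-order mass
    concentrating at the origin survives as a matrix. Infinite radius must carry no mass, which
    follows from bounds on truncated radii that are uniform in the truncation level. Monomials
    divided by [|x|^2] are still unbounded in general; they are truncated at radius [K], with an
    error of order [1/K] paid for by one more power of the radius. *)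

Section Shift.
Context {R : realType} {n : nat}.
Implicit Types (p q : {mpoly R[n]}) (y x : 'I_n -> R) (m al : 'X_{1..n}).

Lemma msize_leP p k : (forall m, (k <= mdeg m)%N -> p@_m = 0) -> (msize p <= k)%N.
Proof.
move=> h; rewrite msizeE; apply/bigmax_leqP_seq => m mp _.
rewrite ltnNge; apply/negP => /h /eqP; rewrite mcoeff_eq0.
by rewrite mp.
Qed.

Lemma mcoeff_msize_le p m : (msize p <= mdeg m)%N -> p@_m = 0.
Proof. by move=> /msize_mdeg_ge /memN_msupp_eq0. Qed.

(** With [c al = (a al).@[y]] this is the operator frozen at [y]; with powers of a point it is
    evaluation, with a Kronecker delta a coefficient. One derivative lemma for [mom] then serves all
    of them. *)
Definition mom (c : 'X_{1..n} -> R) p : R := \sum_(m <- msupp p) p@_m * c m.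

Lemma momwE c p k : (msize p <= k)%N ->
  mom c p = \sum_(m : 'X_{1..n < k}) p@_m * c m.
Proof.
move=> lt_pk; pose I : subFinType _ := 'X_{1..n < k}.
rewrite /mom (big_mksub I) //=; first last.
  by move=> x /msize_mdeg_lt /leq_trans; apply.
  by rewrite msupp_uniq.
by rewrite big_rmcond //= => i; move/memN_msupp_eq0 ->; rewrite mul0r.
Qed.

Lemma mom_is_linear c : linear_for *%R (mom c).
Proof.
move=> t p q; set k := maxn (msize (t *: p + q)) (maxn (msize p) (msize q)).
rewrite !(@momwE c _ k) ?leq_max ?leqnn ?orbT // mulr_sumr -big_split /=.
by apply: eq_bigr => m _; rewrite mcoeffD mcoeffZ mulrDl mulrA.
Qed.

HB.instance Definition _ c := GRing.isLinear.Build R {mpoly R[n]} R *%R (mom c)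
  (mom_is_linear c).

Lemma momX c m : mom c 'X_[m] = c m.
Proof. by rewrite /mom msuppX big_seq1 mcoeffX eqxx mul1r. Qed.

Lemma momC c t : mom c t%:MP = t * c 0%MM.
Proof. by rewrite -[t%:MP]mulr1 mul_mpolyC linearZ /= -mpolyX0 momX. Qed.

Lemma meval_mom x p : p.@[x] = mom (fun m => \prod_i x i ^+ m i) p.
Proof. by []. Qed.

Definition shift y p : {mpoly R[n]} := p \mPo [tuple 'X_i + (y i)%:MP | i < n].

HB.instance Definition _ y := GRing.Linear.copy (shift y)
  (comp_mpoly [tuple 'X_i + (y i)%:MP | i < n]).
HB.instance Definition _ y := GRing.RMorphism.copy (shift y)
  (comp_mpoly [tuple 'X_i + (y i)%:MP | i < n]).

Lemma shift1 y : shift y 1 = 1.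
Proof. exact: comp_mpoly1. Qed.

Lemma shiftM y : {morph shift y : p q / p * q}.
Proof. exact: rmorphM. Qed.

Lemma shiftP y c p q : shift y (c *: p + q) = c *: shift y p + shift y q.
Proof. exact: linearP. Qed.

Lemma shift_eval y p x : (shift y p).@[x] = p.@[fun i => x i + y i].
Proof.
rewrite /shift comp_mpoly_meval; apply: meval_eq => i.
by rewrite tnth_mktuple mevalD mevalXU mevalC.
Qed.

(** Identities between ring morphisms or derivations need checking only on [1] and the variables;
    the properties of [shift] are proved in this way. *)
Lemma mpoly_ring_ind (P : {mpoly R[n]} -> Prop) :
  P 1 -> (forall i, P 'X_i) -> (forall p q, P p -> P q -> P (p * q)) ->
  (forall c p q, P p -> P q -> P (c *: p + q)) -> forall p, P p.
Proof.
move=> P1 PX PM PD p.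
have P0 : P 0 by have := PD (-1) 1 1 P1 P1; rewrite scaleN1r addNr.
rewrite [p]mpolyE; elim: (msupp p) => [|m s IH]; first by rewrite big_nil.
rewrite big_cons; apply: PD => //; rewrite mpolyXE_id.
apply: (big_ind P) => // i _; elim: (m i) => [|k IHk]; rewrite ?expr0 // exprS.
exact: PM.
Qed.

Lemma shiftX y i : shift y 'X_i = 'X_i + (y i)%:MP.
Proof. by rewrite /shift comp_mpolyXU -tnth_nth tnth_mktuple. Qed.

Lemma shiftK y p : shift y (shift (fun i => - y i) p) = p.
Proof.
elim/mpoly_ring_ind: p => [|i|p q Hp Hq|c p q Hp Hq].
- by rewrite !shift1.
- rewrite shiftX (raddfD (shift y)) /= shiftX /shift comp_mpolyC.
  by rewrite mpolyCN addrK.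
- by rewrite !shiftM Hp Hq.
- by rewrite !shiftP Hp Hq.
Qed.

Lemma mderiv_shift y i p : (shift y p)^`M(i) = shift y (p^`M(i)).
Proof.
elim/mpoly_ring_ind: p => [|j|p q Hp Hq|c p q Hp Hq].
- by rewrite shift1 -mpolyC1 mderivC raddf0.
- rewrite shiftX mderivD mderivC addr0 mderivX linearZ /= mnm1E.
  case: eqVneq => [->|ne] /=; last by rewrite !scale0r [RHS]raddf0.
  by rewrite -[X in (X - _)%MM]add0m addmK mpolyX0 shift1.
- by rewrite shiftM !mderivM Hp Hq (raddfD (shift y)) /= !shiftM.
- by rewrite shiftP !(linearP (mderiv i)) /= Hp Hq shiftP.
Qed.

Lemma mderivm_shift y m p : (shift y p)^`M[m] = shift y (p^`M[m]).
Proof.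
rewrite !mderivm_foldr /=; elim: (flatten _) => //= i s ->.
exact: mderiv_shift.
Qed.

Lemma meval0E p : p.@[fun=> 0] = p@_0.
Proof.
rewrite [in LHS](mpolyE p) raddf_sum /= [in RHS](mpolyE p) raddf_sum /=.
apply: eq_bigr => m _; rewrite mevalZ mevalX mcoeffZ mcoeffX; congr (_ * _).
case: eqVneq => [->|m0]; first by rewrite big1 // => i _; rewrite mnm0E.
have [i mi] : exists i, m i != 0%N.
  apply/existsP; rewrite -negb_forall; apply: contra m0 => /forallP h.
  by apply/eqP/mnmP => i; rewrite mnm0E (eqP (h i)).
by rewrite (bigD1 i) //= expr0n (negbTE mi) mul0r.
Qed.

Lemma mfact_neq0 al : (mfact al)%:R != 0 :> R.
Proof. by rewrite pnatr_eq0 -lt0n prodn_gt0 // => i; exact: fact_gt0. Qed.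

(** Taylor's formula: translation moves [y] to the origin, where a derivative is [al!] times a
    coefficient. *)
Lemma mcoeff_shift y p al :
  (shift y p)@_al = (mfact al)%:R^-1 * (p^`M[al]).@[y].
Proof.
apply: (mulfI (mfact_neq0 al)); rewrite mulrA mulfV ?mfact_neq0 // mul1r.
have -> : (p^`M[al]).@[y] = (shift y p^`M[al]).@[fun=> 0].
  by rewrite shift_eval; apply: meval_eq => i; rewrite add0r.
rewrite -mderivm_shift meval0E mcoeff_mderivm addm0 mulr_natl; congr (_ *+ _).
by apply: eq_bigr => i _; rewrite ffactnn.
Qed.

Lemma mderivm_eq0 p al : (msize p <= mdeg al)%N -> p^`M[al] = 0.
Proof.
move=> h; apply/mpolyP => m; rewrite mcoeff_mderivm mcoeff0.
by rewrite mcoeff_msize_le ?mul0rn // mdegD (leq_trans h) ?leq_addr.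
Qed.

Lemma msize_mderivm p al : (msize p^`M[al] <= msize p - mdeg al)%N.
Proof.
apply: msize_leP => m; rewrite leq_subLR -mdegD => h.
by rewrite mcoeff_mderivm mcoeff_msize_le ?mul0rn.
Qed.

Lemma msize_shift y p : (msize (shift y p) <= msize p)%N.
Proof.
apply: msize_leP => m h; rewrite mcoeff_shift mderivm_eq0 // meval0.
by rewrite mulr0.
Qed.
End Shift.

Section Diffop.
Context {R : realType} {n : nat} (a : 'X_{1..n} -> {mpoly R[n]}).
Implicit Types (p q : {mpoly R[n]}) (y x : 'I_n -> R) (m al : 'X_{1..n}).

(** The range of the sum in [diffop] depends on its argument, which hides linearity. A larger common
    range gives the same sum because the extra derivatives vanish. *)
Lemma diffopwE k p : (msize p <= k)%N -> diffop a p =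
  \sum_(al : 'X_{1..n < k}) ((mfact al)%:R^-1 : R) *: (a al * p^`M[al]).
Proof.
move=> pk; pose F al : {mpoly R[n]} :=
  ((mfact al)%:R^-1 : R) *: (a al * p^`M[al]).
rewrite /diffop.
(* Both ranges are compared with one list of multi-indices, produced as the support of a sum of
   monomials. *)
suff h j : (msize p <= j)%N -> \sum_(al : 'X_{1..n < j}) F al =
    \sum_(al <- msupp (\sum_(al : 'X_{1..n < msize p}) 'X_[al] : {mpoly R[n]})) F al.
  by rewrite (h (msize p)) // (h k).
move=> pj; set s := msupp _.
have sE al : (al \in s) = (mdeg al < msize p)%N.
  rewrite mcoeff_msupp raddf_sum /=; case: ltnP => h.
    rewrite (bigD1 (BMultinom h)) //= mcoeffX eqxx big1 ?addr0 ?oner_neq0 //.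
    move=> i; rewrite -val_eqE /= => /negbTE ne; rewrite mcoeffX ne //.
  rewrite big1 ?eqxx // => i _; rewrite mcoeffX; case: eqP => // E.
  by have := bmdeg i; rewrite E ltnNge h.
rewrite [RHS](big_mksub 'X_{1..n < j}) //=; last 2 first.
- exact: msupp_uniq.
- by move=> x; rewrite sE => /leq_trans; apply.
rewrite [RHS]big_rmcond // => i; rewrite sE -leqNgt => h.
by rewrite /F mderivm_eq0 // mulr0 scaler0.
Qed.

Lemma diffop_is_linear : linear (diffop a).
Proof.
move=> t p q; set k := maxn (msize (t *: p + q)) (maxn (msize p) (msize q)).
rewrite !(@diffopwE k) ?leq_max ?leqnn ?orbT // scaler_sumr -big_split /=.
apply: eq_bigr => m _; rewrite linearP /= mulrDr scalerDr; congr (_ + _).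
by rewrite -scalerAr !scalerA mulrC.
Qed.

HB.instance Definition _ := GRing.isLinear.Build R {mpoly R[n]} {mpoly R[n]}
  *:%R (diffop a) diffop_is_linear.

Lemma diffop_eval y p :
  (diffop a p).@[y] = mom (fun al => (a al).@[y]) (shift y p).
Proof.
rewrite (momwE _ (msize_shift y p)) /diffop raddf_sum /=.
apply: eq_bigr => al _; rewrite mevalZ mevalM mcoeff_shift.
by rewrite mulrCA mulrC.
Qed.

Hypothesis ha : forall al : 'X_{1..n}, (msize (a al) <= (mdeg al).+1)%N.

(** Multiplication by [a al] raises the degree by at most the amount by which [al] derivatives have
    lowered it. *)
Lemma msize_diffop p : (msize (diffop a p) <= msize p)%N.
Proof.
rewrite /diffop; elim/big_ind: _ => [|u v hu hv|al _].
- by rewrite msize0.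
- by rewrite (leq_trans (msizeD_le _ _)) // geq_max hu hv.
rewrite (leq_trans (msizeZ_le _ _)) //.
case: (eqVneq (a al * p^`M[al]) 0) => [->|nz]; first by rewrite msize0.
have := nz; rewrite mulf_eq0 negb_or => /andP[a0 p0].
rewrite msizeM //; have := leq_add (ha al) (msize_mderivm p al).
have h : (mdeg al < msize p)%N by exact: bmdeg.
rewrite addSn (subnKC (ltnW h)) => le.
have s0 : (0 < msize (a al))%N by rewrite lt0n msize_poly_eq0.
by rewrite -ltnS prednK // addn_gt0 s0.
Qed.

Lemma msize_iter_diffop k p : (msize (iter k (diffop a) p) <= msize p)%N.
Proof. by elim: k => //= k; apply: leq_trans; exact: msize_diffop. Qed.

End Diffop.

(** * The exponential series *)

Section ExpSeries.
Context {R : realType}.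
Implicit Types (f g : nat -> R) (t c : R).

Definition expseries f t : R := limn (series (fun k => t ^+ k / k`!%:R * f k)).

(** The growth of iterates of a linear map on a finite-dimensional space. It makes the exponential
    series converge for every [t] and survives the index shift caused by differentiation. *)
Definition geometric_bound f := exists K B : R, 0 <= B /\ forall k, `|f k| <= K * B ^+ k.

Lemma geometric_boundS f : geometric_bound f -> geometric_bound (fun k => f k.+1).
Proof.
move=> [K [B [B0 h]]]; exists (K * B), B; split=> // k.
by rewrite -mulrA -exprS.
Qed.

Lemma is_cvg_expseries f t : geometric_bound f ->
  cvgn (series (fun k => t ^+ k / k`!%:R * f k)).
Proof.
move=> [K [B [B0 h]]].
have : cvgn (series (fun k => K * exp_coeff (`|t| * B) k)).
  have -> : series (fun k => K * exp_coeff (`|t| * B) k) = K \*: series (exp_coeff (`|t| * B)).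
    by apply/funext => k; rewrite /series /= /= -mulr_sumr.
  by apply: is_cvgZr; exact: is_cvg_series_exp_coeff.
move=> cv; apply: normed_cvg; apply: series_le_cvg cv => [k|k|k] /=; first exact: normr_ge0.
  rewrite mulr_ge0 ?exp_coeff_ge0 ?mulr_ge0 //.
  by have := le_trans (normr_ge0 _) (h 0%N); rewrite expr0 mulr1.
rewrite /exp_coeff /= exprMn !normrM normrX normfV normr_nat.
have := ler_wpM2l (_ : 0 <= `|t| ^+ k / k`!%:R) (h k).
by rewrite divr_ge0 ?exprn_ge0 // => /(_ isT) /le_trans; apply; lra.
Qed.

Lemma expseries_pseries f : expseries f = (fun t => limn (pseries (fun k => f k / k`!%:R) t)).
Proof.
apply/funext => t; rewrite /expseries /pseries; congr (limn (series _)).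
by apply/funext => k /=; ring.
Qed.

Lemma pseries_diffs_fact f :
  pseries_diffs (fun k => f k / k`!%:R) = (fun k => f k.+1 / k`!%:R).
Proof.
apply/funext => k; rewrite /pseries_diffs factS natrM; field.
by rewrite nat1r !pnatr_eq0 -!lt0n fact_gt0.
Qed.

Lemma is_cvg_pseries_fact f t : geometric_bound f ->
  cvgn (pseries (fun k => f k / k`!%:R) t).
Proof.
move=> /is_cvg_expseries - /(_ t); rewrite /pseries.
suff -> : [sequence f i / i`!%:R * t ^+ i]_i = (fun k => t ^+ k / k`!%:R * f k) by [].
by apply/funext => k /=; ring.
Qed.

Lemma is_derive_expseries f t : geometric_bound f ->
  is_derive t 1 (expseries f) (expseries (fun k => f k.+1) t).
Proof.
move=> gf; have gf1 := geometric_boundS gf; have gf2 := geometric_boundS gf1.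
rewrite !expseries_pseries -pseries_diffs_fact.
apply: (@pseries_snd_diffs _ _ (`|t| + 1)); rewrite ?pseries_diffs_fact.
- exact: is_cvg_pseries_fact.
- exact: is_cvg_pseries_fact.
- exact: is_cvg_pseries_fact.
- by rewrite [`|_ + _|]ger0_norm ?addr_ge0 // ltrDl.
Qed.

Lemma expseries0 f : expseries f 0 = f 0%N.
Proof.
rewrite /expseries; apply/cvg_lim => //.
apply: cvg_near_cst; exists 1%N => // m /= m0; rewrite /series /= big_ltn //.
rewrite big_nat_cond big1 ?addr0 ?expr0 ?fact0 ?divr1 ?mul1r //.
by move=> i /andP[/andP[i0 _] _]; rewrite expr0n gtn_eqF // !mul0r.
Qed.

Lemma expseries_sum (I : Type) (r : seq I) (c : I -> R) (F : I -> nat -> R) t :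
  (forall i, geometric_bound (F i)) ->
  \sum_(i <- r) expseries (F i) t * c i = expseries (fun k => \sum_(i <- r) F i k * c i) t.
Proof.
move=> gF; apply/esym/cvg_lim => //.
rewrite (_ : series _ = fun j => \sum_(i <- r) series (fun k => t ^+ k / k`!%:R * F i k) j * c i).
  apply: cvg_big => [|i _]; first exact: add_continuous.
  by apply: cvgMr_tmp; exact: is_cvg_expseries.
apply/funext => j; rewrite /series /=.
under [RHS]eq_bigr do rewrite mulr_suml.
rewrite exchange_big /=; apply: eq_bigr => k _.
by rewrite mulr_sumr; apply: eq_bigr => i _; rewrite mulrA.
Qed.

End ExpSeries.

(** * The exponential of the operator and its derivative in time *)

Section ExpA.
Context {R : realType} {n : nat} (a : 'X_{1..n} -> {mpoly R[n]}).
Hypothesis ha : forall al : 'X_{1..n}, (msize (a al) <= (mdeg al).+1)%N.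
Implicit Types (p q : {mpoly R[n]}) (c : 'X_{1..n} -> R) (m al : 'X_{1..n}).

(** Composition with the operator stays within the functionals [mom], so the differentiated series,
    whose terms contain [A^(k+1) p], can be read as a value at [e^{tA} p]. *)
Lemma mom_diffop c q :
  mom c (diffop a q) = mom (fun m => mom c (diffop a 'X_[m])) q.
Proof.
rewrite {1}[q]mpolyE (linear_sum (diffop a)) (linear_sum (mom c)) /=.
by apply: eq_bigr => m _; rewrite (linearZ_LR (diffop a)) linearZ.
Qed.

Let nrm d q : R := \sum_(m : 'X_{1..n < d}) `|q@_m|.

Lemma mcoeff_iter_bound p : exists K B : R, 0 <= B /\ forall k m, `|(iter k (diffop a) p)@_m| <= K * B ^+ k.
Proof.
(* [B] bounds the operator norm for the l1 norm of coefficients: it sums the norms of the images of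
   all basis monomials. *)
set d := msize p; pose B := \sum_(m : 'X_{1..n < d}) nrm d (diffop a 'X_[m]).
have nrm0 q : 0 <= nrm d q by apply: sumr_ge0.
have B0 : 0 <= B by apply: sumr_ge0.
exists (nrm d p), B; split=> [//|k m].
have le q : (msize q <= d)%N -> `|q@_m| <= nrm d q.
  move=> qd; case: (ltnP (mdeg m) d) => [md|/(leq_trans qd) h].
    rewrite /nrm (bigD1 (BMultinom md)) //= lerDl; exact: sumr_ge0.
  by rewrite mcoeff_msize_le // normr0.
apply: le_trans (le _ (msize_iter_diffop ha _ _)) _.
elim: k => [|k IH]; first by rewrite expr0 mulr1.
rewrite iterS; set q := iter k _ p.
have qd : (msize q <= d)%N by exact: msize_iter_diffop.
suff h : nrm d (diffop a q) <= nrm d q * B.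
  by rewrite (le_trans h) // exprSr mulrA ler_wpM2r.
rewrite {1}(mpolywE qd) (linear_sum (diffop a)) /=.
apply: (@le_trans _ _ (\sum_(m' : 'X_{1..n < d}) \sum_(m : 'X_{1..n < d})
   `|q@_m'| * `|(diffop a 'X_[m'])@_m|)).
  rewrite exchange_big; apply: ler_sum => i _; rewrite raddf_sum /=.
  rewrite (le_trans (ler_norm_sum _ _ _)) //; apply: ler_sum => j _.
  by rewrite (linearZ_LR (diffop a)) /= mcoeffZ normrM.
rewrite /nrm mulr_suml; apply: ler_sum => i _; rewrite -mulr_sumr.
apply: ler_wpM2l => //; rewrite /B [leRHS](bigD1 i) //= /nrm lerDl.
by apply: sumr_ge0 => j _; exact: sumr_ge0.
Qed.

Lemma geometric_mcoeff p m : geometric_bound (fun k => (iter k (diffop a) p)@_m).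
Proof. by have [K [B [B0 h]]] := mcoeff_iter_bound p; exists K, B; split. Qed.

Lemma msize_expA t p : (msize (expA a t p) <= msize p)%N.
Proof.
apply: msize_leP => m h; rewrite /expA raddf_sum /= big1 // => i _.
rewrite mcoeffZ mcoeffX; case: eqP => E; rewrite ?mulr0 //.
by have := bmdeg i; rewrite E ltnNge h.
Qed.

Lemma mcoeff_expA t p m :
  (expA a t p)@_m = expseries (fun k => (iter k (diffop a) p)@_m) t.
Proof.
have [h|h] := ltnP (mdeg m) (msize p).
  rewrite /expA raddf_sum /= (bigD1 (BMultinom h)) //= big1 ?addr0.
    by rewrite mcoeffZ mcoeffX eqxx mulr1.
  move=> i; rewrite -val_eqE /= => /negbTE ne.
  by rewrite mcoeffZ mcoeffX ne mulr0.
rewrite mcoeff_msize_le ?(leq_trans (msize_expA _ _)) //.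
apply/esym/cvg_lim => //; apply: cvg_near_cst; near=> k.
rewrite /series /= big1 // => i _.
by rewrite mcoeff_msize_le ?mulr0 // (leq_trans (msize_iter_diffop _ _ _)).
Unshelve. all: by end_near. Qed.

Lemma mom_expA c t p :
  mom c (expA a t p) = expseries (fun k => mom c (iter k (diffop a) p)) t.
Proof.
rewrite (momwE _ (msize_expA t p)).
under eq_bigr do rewrite mcoeff_expA.
rewrite expseries_sum; last by move=> i; exact: geometric_mcoeff.
congr expseries; apply/funext => k.
by rewrite (momwE _ (msize_iter_diffop ha k p)).
Qed.

Lemma geometric_mom c p : geometric_bound (fun k => mom c (iter k (diffop a) p)).
Proof.
have [K [B [B0 h]]] := mcoeff_iter_bound p.
exists (\sum_(m : 'X_{1..n < msize p}) K * `|c m|), B; split=> // k.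
rewrite (momwE _ (msize_iter_diffop ha k p)) (le_trans (ler_norm_sum _ _ _)) //.
rewrite mulr_suml; apply: ler_sum => m _.
by rewrite normrM mulrAC ler_wpM2r.
Qed.

Lemma is_derive_mom_expA c (t : R) p : is_derive t (1 : R) (fun t => mom c (expA a t p) : R)
  (mom c (diffop a (expA a t p))).
Proof.
rewrite mom_diffop mom_expA.
rewrite (_ : (fun t => mom c (expA a t p)) =
    expseries (fun k => mom c (iter k (diffop a) p))); last first.
  by apply/funext => s; rewrite mom_expA.
have e : (fun k => mom (fun m => mom c (diffop a 'X_[m])) (iter k (diffop a) p)) =
    (fun k => mom c (iter k.+1 (diffop a) p)).
  by apply/funext => k; rewrite iterS -mom_diffop.
by rewrite e; apply: is_derive_expseries; exact: geometric_mom.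
Qed.

End ExpA.

Section OneSidedDerivative.
Context {R : realType}.
Local Open Scope classical_set_scope.

(** The sign [s] selects the side. At time [0] only later times are available, whereas a minimum in
    space-time may sit at the final time and is compared with earlier ones. *)
Lemma is_derive_sign_ge0 (f : R -> R) (x D s d : R) : `|s| = 1 -> 0 < d ->
  is_derive x (1 : R) f D -> (forall h, 0 < h < d -> f x <= f (x + s * h)) ->
  0 <= s * D.
Proof.
move=> s1 d0 [df dv] fx; rewrite leNgt; apply/negP => sD.
have ss : s * s = 1.
  by rewrite -expr2 -real_normK ?num_real // s1 expr1n.
have : h^-1 *: (f (h *: 1 + x) - f x) @[h --> 0^'] --> D.
  by rewrite -dv; exact: df.
move=> /cvgrPdist_lt /(_ `|D|); rewrite normr_gt0 => /(_ _).
have D0 : D != 0 by apply/eqP => D0; rewrite D0 mulr0 ltxx in sD.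
move=> /(_ D0) [e /= e0 he].
pose h := Num.min e d / 2.
have m0 : 0 < Num.min e d by rewrite lt_min e0 d0.
have h0 : 0 < h by rewrite divr_gt0.
have hm : h < Num.min e d by rewrite /h; lra.
move: (hm); rewrite lt_min => /andP[hme hmd].
have s0 : s != 0 by rewrite -normr_eq0 s1 oner_neq0.
have := he (s * h); rewrite /ball_ /= sub0r normrN normrM s1 mul1r gtr0_norm // => /(_ hme).
have sh0 : s * h != 0 by rewrite mulf_neq0 // gt_eqF.
move=> /(_ sh0); rewrite /GRing.scale /= mulr1 [s * h + x]addrC.
have /fx {fx} : 0 < h < d by rewrite h0 hmd.
set Q := f _ - f x => fx.
have Q0 : 0 <= Q by rewrite subr_ge0.
have -> : (s * h)^-1 * Q = s * (Q / h).
  have sv : s^-1 = s by apply: (mulfI s0); rewrite mulfV // ss.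
  by rewrite invfM sv; ring.
have Qh : 0 <= Q / h by rewrite divr_ge0 // ltW.
have -> : `|D| = - (s * D).
  by rewrite -[LHS]mul1r -s1 -normrM ltr0_norm.
have -> : `|D - s * (Q / h)| = `|s * D - Q / h|.
  have -> : s * D - Q / h = s * (D - s * (Q / h)).
    by rewrite -[in LHS](mul1r (Q / h)) -ss; ring.
  by rewrite normrM s1 mul1r.
by rewrite ltr0_norm; lra.
Qed.
End OneSidedDerivative.

Section Growth.
Context {R : realType} {n : nat}.
Implicit Types (p q : {mpoly R[n]}) (x y : 'I_n -> R) (m al : 'X_{1..n}).

Definition onep_normsq : {mpoly R[n]} := 1 + \sum_(i < n) 'X_i ^+ 2.

Lemma onep_normsqE x : onep_normsq.@[x] = 1 + \sum_i x i ^+ 2.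
Proof.
rewrite mevalD meval1 raddf_sum /=; congr (_ + _).
by apply: eq_bigr => i _; rewrite rmorphXn /= mevalXU.
Qed.

Lemma onep_normsq_ge1 x : 1 <= onep_normsq.@[x].
Proof. by rewrite onep_normsqE lerDl; apply: sumr_ge0 => i _; exact: sqr_ge0. Qed.

Lemma onep_normsq_ge_sqr x i : x i ^+ 2 <= onep_normsq.@[x].
Proof.
rewrite onep_normsqE (bigD1 i) //= addrCA lerDl addr_ge0 //.
by apply: sumr_ge0 => j _; exact: sqr_ge0.
Qed.

Lemma meval_onep_normsqX x k : (onep_normsq ^+ k).@[x] = onep_normsq.@[x] ^+ k.
Proof. by rewrite rmorphXn. Qed.

Lemma onep_normsqX_ge1 x k : 1 <= onep_normsq.@[x] ^+ k.
Proof. by rewrite exprn_ege1 // onep_normsq_ge1. Qed.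

(** After squaring, no parity question arises: [x^(2m)] is at most the power [mdeg m] of
    [1 + |x|^2], and [mdeg m <= 2k]. *)
Lemma monomial_bound x m k : (mdeg m <= k.*2)%N ->
  `|\prod_i x i ^+ m i| <= onep_normsq.@[x] ^+ k.
Proof.
move=> mk; have W1 := onep_normsq_ge1 x.
have W0 : 0 <= onep_normsq.@[x] by apply: le_trans W1.
rewrite -(@ler_pXn2r _ 2) ?nnegrE ?exprn_ge0 // -normrX -prodrXl normr_prod.
apply: (@le_trans _ _ (onep_normsq.@[x] ^+ mdeg m)).
  rewrite mdegE -prodrXr; apply: ler_prod => i _; rewrite normr_ge0 /=.
  rewrite exprAC normrX lerXn2r ?nnegrE //.
  by rewrite ger0_norm ?sqr_ge0 // onep_normsq_ge_sqr.
by rewrite -exprM muln2 ler_weXn2l.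
Qed.

Lemma poly_bound q k : (msize q <= k.*2.+1)%N -> forall x,
  `|q.@[x]| <= (\sum_(m <- msupp q) `|q@_m|) * onep_normsq.@[x] ^+ k.
Proof.
move=> qk x; rewrite mevalE (le_trans (ler_norm_sum _ _ _)) // mulr_suml.
rewrite big_seq [leRHS]big_seq; apply: ler_sum => m mq; rewrite normrM.
rewrite ler_wpM2l // monomial_bound // -ltnS (leq_trans _ qk) //.
exact: msize_mdeg_lt.
Qed.

Lemma msize_onep_normsqX k : (msize (onep_normsq ^+ k) <= k.*2.+1)%N.
Proof.
elim: k => [|k IH]; first by rewrite expr0 msize1.
rewrite exprS; case: (eqVneq (onep_normsq * onep_normsq ^+ k) 0) => [->|].
  by rewrite msize0.
rewrite mulf_eq0 negb_or => /andP[w0 wk0]; rewrite msizeM //.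
have w3 : (msize onep_normsq <= 3)%N.
  rewrite (leq_trans (msizeD_le _ _)) // geq_max msize1 /=.
  elim/big_ind: _ => [|u v hu hv|i _]; first by rewrite msize0.
    by rewrite (leq_trans (msizeD_le _ _)) // geq_max hu hv.
  by rewrite mpolyXn msizeX mdegMn mdeg1.
have := leq_add w3 IH.
case: (msize onep_normsq + _)%N => // j; rewrite doubleS.
Qed.

End Growth.

(** * Conditional positivity and the maximum principle *)

Lemma is_derive_expRZ (R : realType) (c s : R) :
  is_derive s (1 : R) (fun s : R => expR (c * s)) (c * expR (c * s)).
Proof.
have h := is_deriveZ c (is_derive_id s (1 : R)).
have := is_derive1_comp (is_derive_expR (c * s)) h.
by move=> h2; apply: is_derive_eq h2 _; rewrite /GRing.scale /= mulr1 mulrC.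
Qed.

Section MaximumPrinciple.
Local Open Scope classical_set_scope.
Context {R : realType} {n : nat} (a : 'X_{1..n} -> {mpoly R[n]}).
Hypothesis ha : forall al : 'X_{1..n}, (msize (a al) <= (mdeg al).+1)%N.
Implicit Types (p q : {mpoly R[n]}) (x y : 'I_n -> R) (m al : 'X_{1..n}).

Definition conditionally_positive (c : 'X_{1..n} -> R) :=
  forall q, Pos q -> q.@[fun=> 0] = 0 -> 0 <= mom c q.

Lemma Pos_shift y q : Pos q -> Pos (shift y q).
Proof. by move=> q0 x; rewrite shift_eval. Qed.

Lemma is_derive_meval_expA (t : R) p y :
  is_derive t (1 : R) (fun t => (expA a t p).@[y] : R) (diffop a (expA a t p)).@[y].
Proof. exact: is_derive_mom_expA. Qed.

Lemma expA0 p : expA a 0 p = p.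
Proof. by apply/mpolyP => m; rewrite mcoeff_expA // expseries0. Qed.

Lemma preserver_conditionally_positive :
  (forall t : R, 0 <= t -> forall p : {mpoly R[n]}, Pos p -> Pos (expA a t p)) ->
  forall y, conditionally_positive (fun al => (a al).@[y]).
Proof.
move=> hA y q q0 q00; set p := shift (fun i => - y i) q.
have -> : mom (fun al => (a al).@[y]) q = (diffop a p).@[y].
  by rewrite diffop_eval shiftK.
have p0 : Pos p by exact: Pos_shift.
have py : p.@[y] = 0.
  by rewrite shift_eval -q00; apply: meval_eq => i; rewrite subrr.
have := is_derive_meval_expA 0 p y; rewrite expA0 => D.
rewrite -[leRHS]mul1r; apply: (is_derive_sign_ge0 _ (ltr01) D); first exact: normr1.
by move=> h /andP[h0 _]; rewrite expA0 py; apply: hA => //; lra.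
Qed.

Hypothesis cp : forall y, conditionally_positive (fun al => (a al).@[y]).

(** Subtracting the minimal value and moving [y] to the origin gives a test polynomial for
    conditional positivity. The subtracted constant is only multiplied by [a_0], itself constant by
    the degree bound. *)
Lemma diffop_at_minimum y q : (forall x, q.@[y] <= q.@[x]) ->
  (a 0%MM)@_0 * q.@[y] <= (diffop a q).@[y].
Proof.
move=> ymin; set c := q.@[y].
have a0 : a 0%MM = ((a 0%MM)@_0)%:MP.
  by apply: msize1_polyC; rewrite (leq_trans (ha _)) // mdeg0.
have q0 : Pos (shift y (q - c%:MP)).
  by apply: Pos_shift => x; rewrite mevalB mevalC subr_ge0.
have := cp y q0; rewrite -diffop_eval.
rewrite shift_eval (_ : _.@[_] = 0); last first.
  rewrite mevalB mevalC; apply/eqP; rewrite subr_eq0; apply/eqP.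
  by apply: meval_eq => i; rewrite add0r.
move=> /(_ erefl); rewrite (linearB (diffop a)) /= mevalB subr_ge0.
suff -> : (diffop a c%:MP).@[y] = (a 0%MM)@_0 * c by [].
by rewrite diffop_eval /shift comp_mpolyC momC a0 mevalC mulrC mcoeffC eqxx mulr1.
Qed.

Lemma continuous_meval (T : topologicalType) (c : T -> {mpoly R[n]}) (f : T -> 'I_n -> R) k :
  (forall t, (msize (c t) <= k)%N) -> (forall m, continuous (fun t => (c t)@_m)) ->
  (forall i, continuous (fun t => f t i)) ->
  continuous (fun t => (c t).@[f t]).
Proof.
move=> ck cc cf.
rewrite (_ : (fun t => _) = fun t => \sum_(m : 'X_{1..n < k}) (c t)@_m * \prod_i f t i ^+ m i).
  move=> t; apply: cvg_big => [|m _]; first exact: add_continuous.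
  apply: cvgM; first exact: cc.
  apply: cvg_big => [|i _]; first exact: mul_continuous.
  apply: (@continuous_comp _ _ _ (fun t => f t i) (fun z => z ^+ m i)).
    exact: cf.
  exact: exprn_continuous.
by apply/funext => t; rewrite meval_mom (momwE _ (ck t)).
Qed.

Lemma mcoeff_momE q m : q@_m = mom (fun m' => (m' == m)%:R) q.
Proof.
rewrite [in LHS](mpolyE q) raddf_sum /=; apply: eq_bigr => m' _.
by rewrite mcoeffZ mcoeffX.
Qed.

Lemma continuous_mcoeff_expA p m : continuous (fun t : R => (expA a t p)@_m).
Proof.
move=> t; apply: differentiable_continuous.
have [d _] := is_derive_mom_expA ha (fun m' => (m' == m)%:R) t p.
rewrite (_ : (fun t => _) = (fun t : R => mom (fun m' => (m' == m)%:R) (expA a t p))).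
  exact/derivable1_diffP.
by apply/funext => s; rewrite mcoeff_momE.
Qed.

Lemma expA_bound p T d : (msize p <= d.*2.+1)%N -> 0 <= T -> exists K : R, 0 <= K /\
  forall (t : R) x, 0 <= t <= T -> `|(expA a t p).@[x]| <= K * onep_normsq.@[x] ^+ d.
Proof.
move=> pd T0.
have h m : exists K : R, forall t, 0 <= t <= T -> `|(expA a t p)@_m| <= K.
  have cf : {within `[0, T], continuous (fun t => `|(expA a t p)@_m|)}.
    apply: continuous_subspaceT => t; apply: cvg_norm; exact: continuous_mcoeff_expA.
  have [c _ hc] := EVT_max T0 cf.
  by exists `|(expA a c p)@_m| => t tT; apply: hc; rewrite in_itv.
have [K hK] := choice h.
have K0 m : 0 <= K m by apply: le_trans (hK m 0 _); rewrite ?lexx.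
exists (\sum_(m : 'X_{1..n < d.*2.+1}) K m); split; first exact: sumr_ge0.
move=> t x tT; rewrite meval_mom (momwE _ (leq_trans (msize_expA _ _ _) pd)).
rewrite (le_trans (ler_norm_sum _ _ _)) // mulr_suml; apply: ler_sum => m _.
rewrite normrM; apply: ler_pM => //; first exact: hK.
by apply: monomial_bound; rewrite -ltnS; exact: bmdeg.
Qed.

Lemma conditionally_positive_preserver (t : R) p :
  0 <= t -> Pos p -> Pos (expA a t p).
Proof.
move=> t0 p0 x; rewrite leNgt; apply/negP => neg.
set d := msize p.
have pd : (msize p <= d.*2.+1)%N by rewrite -addnn -/d leqW // leq_addr.
have [K [K0 hK]] := expA_bound pd t0.
(* One power of [onep_normsq] more than the bound on [e^{sA} p], uniform in time, which makes the
   perturbed function coercive. *)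
pose V : {mpoly R[n]} := onep_normsq ^+ d.+1.
have V1 z : 1 <= V.@[z] by rewrite meval_onep_normsqX onep_normsqX_ge1.
(* The operator does not raise degrees, so [A V] is bounded by a multiple of [V]; hence [e^{Cs} V]
   is a supersolution of the evolution equation. *)
have [C [C0 hC]] : exists C : R, 0 <= C /\ forall z, (diffop a V).@[z] <= C * V.@[z].
  exists (\sum_(m <- msupp (diffop a V)) `|(diffop a V)@_m|); split.
    by apply: sumr_ge0.
  move=> z; rewrite meval_onep_normsqX (le_trans (ler_norm _)) // poly_bound //.
  exact: leq_trans (msize_diffop ha _) (msize_onep_normsqX _).
(* Any rate above [a_0] would do: the factor [exp(- la s)] gives the zeroth-order term a strict sign
   where [w] is negative. *)
set a0 := (a 0%MM)@_0; set la : R := `|a0| + 1.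
have la0 : a0 < la by rewrite /la; have := ler_norm a0; lra.
pose F (s : R) := expR (C * s).
have F1 s : 0 <= s -> 1 <= F s by move=> s0; rewrite /F (le_trans _ (expR_ge1Dx _)) // lerDl mulr_ge0.
(* With this value the perturbation at [(t, x)] cancels half of the negative value there, so [w t]
   is still negative at [x]. *)
pose eps := - (expA a t p).@[x] / (2 * F t * V.@[x]).
have FV0 s z : 0 < F s * V.@[z] by rewrite mulr_gt0 ?expR_gt0 // (lt_le_trans ltr01).
have eps0 : 0 < eps.
  by rewrite divr_gt0 // ?oppr_gt0 // -mulrA mulr_gt0.
pose w s : {mpoly R[n]} := expA a s p + (eps * F s) *: V.
have wE s z : (w s).@[z] = (expA a s p).@[z] + eps * F s * V.@[z].
  by rewrite mevalD mevalZ.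
have wneg : (w t).@[x] < 0.
  rewrite wE (_ : eps * F t * V.@[x] = - (expA a t p).@[x] / 2); first by lra.
  have /lt0r_neq0 := FV0 t x; rewrite mulf_eq0 negb_or => /andP[Fn Vn].
  by rewrite /eps; field; rewrite Fn Vn.
(* If some [|z i| > r], then [onep_normsq] at [z] is at least [r], hence exceeds [K / eps], and
   [eps V] beats the bound on [e^{sA} p]. Since [r >= 1], a square of a number above [r] is also
   above [r]. *)
pose r := K / eps + 1.
have r1 : 1 <= r by rewrite lerDr divr_ge0 // ltW.
have outside s z i : 0 <= s <= t -> r < `|z i| -> 0 < (w s).@[z].
  move=> st rz; rewrite wE.
  have W0 : 0 < onep_normsq.@[z] by exact: lt_le_trans (onep_normsq_ge1 z).
  have Wr : r <= onep_normsq.@[z].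
    apply: le_trans (onep_normsq_ge_sqr z i); rewrite -[leRHS]real_normK ?num_real //.
    rewrite -[r]mulr1 expr2; apply: ler_pM; rewrite ?(le_trans ler01) //.
      exact: ltW.
    exact: le_trans r1 (ltW rz).
  have := hK s z st; rewrite ler_norml => /andP[lo _].
  have : K * onep_normsq.@[z] ^+ d < eps * F s * V.@[z].
    rewrite meval_onep_normsqX exprS mulrA ltr_pM2r ?exprn_gt0 //.
    apply: (@lt_le_trans _ _ (eps * onep_normsq.@[z])).
      rewrite -ltr_pdivrMl // mulrC; apply: lt_le_trans Wr.
      by rewrite /r ltrDl.
    rewrite -mulrA ler_pM2l // ler_peMl ?(ltW W0) // F1 //.
    by case/andP: st.
  move=> lt; apply: (@lt_le_trans _ _ (eps * F s * V.@[z] - K * onep_normsq.@[z] ^+ d)).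
    by rewrite subr_gt0.
  by rewrite addrC lerD2r.
pose G (u : R * 'rV[R]_n) := expR (- la * u.1) * (w u.1).@[fun i => u.2 ord0 i].
have cG : continuous G.
  move=> u; apply: cvgM.
    apply: (@continuous_comp _ _ _ (fun u : R * 'rV[R]_n => - la * u.1) expR).
      by apply: cvgM; [exact: cvg_cst|exact: cvg_fst].
    exact: continuous_expR.
  apply: (@continuous_meval _ (fun u => w u.1) _ (maxn (msize p) (msize V))).
  - move=> v; rewrite (leq_trans (msizeD_le _ _)) // geq_max.
    rewrite !leq_max msize_expA // orTb.
    by rewrite msizeZ_le orbT.
  - move=> m v.
    rewrite (_ : (fun t => _) = (fun v : R * 'rV[R]_n => (expA a v.1 p)@_m + eps * F v.1 * V@_m)).
      apply: cvgD.
        apply: (@continuous_comp _ _ _ (@fst R 'rV[R]_n) (fun s => (expA a s p)@_m)).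
          exact: cvg_fst.
        exact: continuous_mcoeff_expA.
      apply: cvgM; last exact: cvg_cst.
      apply: cvgM; first exact: cvg_cst.
      apply: (@continuous_comp _ _ _ (fun u : R * 'rV[R]_n => C * u.1) expR).
        by apply: cvgM; [exact: cvg_cst|exact: cvg_fst].
      exact: continuous_expR.
    by apply/funext => s; rewrite mcoeffD mcoeffZ.
  - move=> i v.
    apply: (@continuous_comp _ _ _ (@snd R 'rV[R]_n) (fun s : 'rV[R]_n => s ord0 i)).
      exact: cvg_snd.
    exact: coord_continuous.
pose box : set (R * 'rV[R]_n) :=
  `[0, t] `*` [set v : 'rV[R]_n | forall i, `[- r, r]%classic (v ord0 i)].
have cbox : compact box.
  apply: compact_setX; first exact: segment_compact.
  by apply: (@rV_compact R n (fun=> `[- r, r])) => i; exact: segment_compact.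
pose u1 : R * 'rV[R]_n := (t, \row_i x i).
have u1G : G u1 < 0.
  rewrite /G /= pmulr_rlt0 ?expR_gt0 //.
  by rewrite (meval_eq (v2 := x)) // => i; rewrite mxE.
have inbox s z : 0 <= s <= t -> (w s).@[z] <= 0 -> box (s, \row_i z i).
  move=> st ws; split => /=; first by rewrite in_itv.
  move=> i; rewrite mxE /= in_itv /= -ler_norml leNgt.
  by apply/negP => /(outside s z i st); rewrite ltNge ws.
have box0 : box !=set0.
  by exists u1; apply: inbox (ltW wneg); rewrite t0 lexx.
have [u ubox umin] := compact_EVT_min box0 cbox (continuous_subspaceT cG).
move: ubox; rewrite inE => ubox.
pose s : R := u.1; pose y : 'I_n -> R := fun i => u.2 ord0 i.
have sT : 0 <= s <= t by have := ubox.1; rewrite /= in_itv.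
have Gs : G u < 0.
  apply: le_lt_trans u1G; apply: umin; rewrite inE.
  by apply: inbox (ltW wneg); rewrite t0 lexx.
have wsy : (w s).@[y] < 0.
  by move: Gs; rewrite /G -/s -/y pmulr_rlt0 ?expR_gt0.
(* Outside the box [w] is positive while [G u] is negative, so the minimum over the box is one over
   all of space and all times in [[0, t]]. *)
have Gmin s' z : 0 <= s' <= t -> G u <= expR (- la * s') * (w s').@[z].
  move=> st'; have [pos|npos] := ltP 0 (w s').@[z].
    by rewrite (le_trans (ltW Gs)) // mulr_ge0 ?expR_ge0 // ltW.
  have := umin (s', \row_i z i); rewrite inE => /(_ (inbox _ _ st' npos)).
  rewrite {2}/G /= (meval_eq (v2 := z)) // => i; by rewrite mxE.
have sgt0 : 0 < s.
  rewrite lt_neqAle eq_sym (andP sT).1 andbT; apply/eqP => s0.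
  move: wsy; rewrite wE s0 expA0; apply/negP; rewrite -leNgt.
  by rewrite addr_ge0 // -mulrA mulr_ge0 // ltW.
have ymin z : (w s).@[y] <= (w s).@[z].
  by have := Gmin s z sT; rewrite /G -/s -/y ler_pM2l ?expR_gt0.
have Aw := diffop_at_minimum ymin.
have D := is_derive_meval_expA s p y.
pose g s := expR (- la * s) * ((expA a s p).@[y] + eps * F s * V.@[y]).
have Dg : is_derive s (1 : R) g (expR (- la * s) * ((diffop a (expA a s p)).@[y]
    + eps * (C * F s) * V.@[y] - la * (w s).@[y])).
  have D1 := is_derive_expRZ (- la) s; have D2 := is_derive_expRZ C s.
  have D3 : is_derive s (1 : R) (fun s => (expA a s p).@[y] + eps * F s * V.@[y])
      ((diffop a (expA a s p)).@[y] + eps * V.@[y] * (C * F s)).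
    rewrite (_ : (fun s => _) = (fun s => (expA a s p).@[y]) + (eps * V.@[y]) \*: F).
      exact: is_deriveD.
    by apply/funext => z; rewrite /GRing.add /= mulrAC.
  apply: is_derive_eq; rewrite wE /F /GRing.scale /=.
  by ring.
(* Compared with earlier times, the minimum has a nonpositive time derivative; the spatial
   inequality at the minimum makes the same derivative positive. *)
have : 0 <= -1 * (expR (- la * s) * ((diffop a (expA a s p)).@[y]
    + eps * (C * F s) * V.@[y] - la * (w s).@[y])).
  apply: (is_derive_sign_ge0 _ sgt0 Dg); first by rewrite normrN1.
  move=> h /andP[h0 hs]; rewrite /g -!wE.
  by apply: Gmin; move: sT; lra.
rewrite mulN1r oppr_ge0 pmulr_rle0 ?expR_gt0 //.
apply/negP; rewrite -ltNge.
have AwE : diffop a (w s) = diffop a (expA a s p) + (eps * F s) *: diffop a V.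
  by rewrite /w (linearD (diffop a)) (linearZ_LR (diffop a)).
move: Aw; rewrite AwE (mevalD _ (diffop a _)) (mevalZ _ _ (diffop a _)).
have eF : 0 < eps * F s by rewrite mulr_gt0 // expR_gt0.
have hCy : eps * F s * (diffop a V).@[y] <= eps * (C * F s) * V.@[y].
  have -> : eps * (C * F s) * V.@[y] = eps * F s * (C * V.@[y]) by ring.
  by rewrite ler_pM2l.
have lw : 0 < a0 * (w s).@[y] - la * (w s).@[y].
  by rewrite -mulrBl nmulr_rgt0 // subr_lt0.
move=> Aw; rewrite subr_gt0; apply: (@lt_le_trans _ _ (a0 * (w s).@[y])).
  by rewrite -subr_gt0.
by apply: le_trans Aw _; rewrite lerD2l.
Qed.

End MaximumPrinciple.

(** * From a Levy measure to conditional positivity *)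

Section PositiveSemidefinite.
Context {R : realType} {n : nat}.
Implicit Types (S : 'I_n -> 'I_n -> R) (u v : 'I_n -> R) (i j : 'I_n).

Definition bform S u v : R := \sum_i \sum_j u i * S i j * v j.

Let delta i : 'I_n -> R := fun j => (j == i)%:R.

Lemma bform_delta S i v : bform S (delta i) v = \sum_j S i j * v j.
Proof.
rewrite /bform (bigD1 i) //= [X in _ + X]big1 ?addr0.
  by apply: eq_bigr => j _; rewrite /delta eqxx mul1r.
move=> k /negbTE ki; rewrite big1 // => j _.
by rewrite /delta ki !mul0r.
Qed.

Lemma sum_delta (F : 'I_n -> R) i : \sum_j F j * delta i j = F i.
Proof.
rewrite (bigD1 i) //= /delta eqxx mulr1 big1 ?addr0 // => k /negbTE ki.
by rewrite ki mulr0.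
Qed.

Lemma bform_add_delta S v (t : R) i : (forall i j, S i j = S j i) ->
  bform S (fun j => v j + t * delta i j) (fun j => v j + t * delta i j) =
  bform S v v + 2 * t * (\sum_j S i j * v j) + t ^+ 2 * S i i.
Proof.
move=> sym; have -> : \sum_j S i j * v j = bform S (delta i) v by rewrite bform_delta.
have -> : S i i = bform S (delta i) (delta i) by rewrite bform_delta sum_delta.
have e : bform S (delta i) v = bform S v (delta i).
  rewrite /bform exchange_big /=; apply: eq_bigr => k _; apply: eq_bigr => j _.
  by rewrite sym; ring.
rewrite (_ : 2 * t * _ = t * bform S v (delta i) + t * bform S (delta i) v); last first.
  by rewrite -e; ring.
rewrite /bform !mulr_sumr -!big_split /=; apply: eq_bigr => k _.
rewrite !mulr_sumr -!big_split /=; apply: eq_bigr => j _; ring.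
Qed.

Lemma affine_ge0_slope (A B : R) : (forall t : R, 0 <= A + t * B) -> B = 0.
Proof.
move=> h; apply/eqP/negPn/negP => B0.
by have := h (- (A + 1) / B); rewrite mulfVK //; lra.
Qed.

(** Symmetric Gaussian elimination, by induction on the number of nonzero diagonal entries: removing
    the rank-one matrix of a pivot row leaves the Schur complement. Once the matrix is a sum of
    terms [v v^T], its pairing with the quadratic part of a polynomial is a sum of values of that
    part. *)
Lemma psd_rank1_decomposition S : (forall i j, S i j = S j i) ->
  (forall v, 0 <= bform S v v) ->
  exists s : seq ('I_n -> R), forall i j, S i j = \sum_(v <- s) v i * v j.
Proof.
have [k] := ubnP #|[set i | S i i != 0]%SET|.
elim: k S => // k IH S; rewrite ltnS => Sk sym psd.
have diag i : 0 <= S i i.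
  by have := psd (delta i); rewrite bform_delta sum_delta.
have row0 i : S i i = 0 -> forall j, S i j = 0.
  move=> Si0 j.
  have : 2 * (\sum_l S i l * delta j l) = 0.
    (* As [S i i = 0], the form is affine in [t] along this line, and a nonnegative affine function
       has slope zero. *)
    apply: (@affine_ge0_slope (bform S (delta j) (delta j))) => t.
    have := psd (fun l => delta j l + t * delta i l).
    by rewrite bform_add_delta // Si0 mulr0 addr0 -mulrA [2 * _]mulrC -mulrA [_ * 2]mulrC.
  by rewrite sum_delta; lra.
have [[i Si]|S0] := pselect (exists i, S i i != 0); last first.
  exists [::] => i j; rewrite big_nil; apply: row0; apply/eqP/negPn/negP => ?.
  by apply: S0; exists i.
have Sip : 0 < S i i by rewrite lt_neqAle eq_sym Si diag.
pose S' j l := S j l - S j i * S i l / S i i.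
have [|j l|v|s hs] := IH S'.
- apply: leq_trans Sk; apply: proper_card; apply/properP; split.
    apply/fintype.subsetP => j; rewrite !inE; apply: contra => /eqP Sj.
    by rewrite /S' Sj (row0 _ Sj) !mul0r subrr.
  by exists i; rewrite !inE ?Si // /S' mulfK // subrr eqxx.
- by rewrite /S' (sym j l) (sym j i) (sym i l); congr (_ - _ / _); rewrite mulrC.
- have e : bform S' v v = bform S v v - (\sum_j S i j * v j) ^+ 2 / S i i.
    rewrite expr2 -mulrA mulr_suml -sumrB; apply: eq_bigr => j _.
    rewrite mulrA mulr_sumr mulr_suml -sumrB; apply: eq_bigr => l _.
    by rewrite /S' (sym j i); field.
  (* This multiple of [delta i] minimises the form along the line through [v]; the minimum is the
     value of the Schur complement at [v]. *)
  have := psd (fun l => v l + (- (\sum_j S i j * v j) / S i i) * delta i l).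
  rewrite bform_add_delta // e => /le_trans; apply.
  rewrite le_eqVlt; apply/orP; left; apply/eqP; field; exact: Si.
exists ((fun j => S i j / Num.sqrt (S i i)) :: s) => j l.
rewrite big_cons -hs /S' (sym j i).
have -> : S i j / Num.sqrt (S i i) * (S i l / Num.sqrt (S i i)) =
    S i j * S i l / (Num.sqrt (S i i) ^+ 2).
  by field; rewrite sqrtr_eq0 -ltNge.
by rewrite sqr_sqrtr // addrC subrK.
Qed.

Lemma psd_sym_decomposition (S : 'M[R]_n) : psd_sym S ->
  exists s : seq ('I_n -> R), forall i j, S i j = \sum_(v <- s) v i * v j.
Proof.
move=> [symS psdS]; apply: psd_rank1_decomposition => [i j|v].
  by rewrite -[in LHS]symS mxE.
have := psdS (\col_i v i); rewrite -mulmxA !mxE; congr (0 <= _).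
apply: eq_bigr => i _; rewrite !mxE mulr_sumr; apply: eq_bigr => j _.
by rewrite !mxE mulrA.
Qed.

End PositiveSemidefinite.

(** * Second-order behaviour of nonnegative polynomials at a zero *)

Section PolyNearZero.
Context {R : realType}.
Local Open Scope classical_set_scope.

Lemma horner_ge0_at0 (P : {poly R}) : (forall s, 0 < s -> 0 <= P.[s]) -> 0 <= P.[0].
Proof.
move=> h.
have c : P.[s] @[s --> 0^'+] --> P.[0].
  by apply: cvg_at_right_filter; exact: continuous_horner.
apply: (cvgr_to_ge c); near=> s; apply: h.
by near: s; exact: nbhs_right_gt.
Unshelve. all: by end_near. Qed.

Lemma poly_factorX (P : {poly R}) : P.[0] = 0 -> exists Q, P = Q * 'X.
Proof. by move=> /eqP/factor_theorem [Q]; rewrite subr0 => ->; exists Q. Qed.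

(** The quotient by [X] is nonnegative to the right of [0] and nonpositive to the left, so it
    vanishes at [0]. The quotient by [X^2] is then nonnegative to the right, hence at [0]. *)
Lemma nonneg_poly_coef (P : {poly R}) : (forall s, 0 <= P.[s]) -> P.[0] = 0 ->
  P`_1 = 0 /\ 0 <= P`_2.
Proof.
move=> P0 /poly_factorX [Q PQ].
have QsP s : Q.[s] * s = P.[s] by rewrite PQ hornerM hornerX.
have Q0 : Q.[0] = 0.
  apply/eqP; rewrite eq_le; apply/andP; split; last first.
    by apply: horner_ge0_at0 => s s0; have := P0 s; rewrite -QsP pmulr_lge0.
  have := @horner_ge0_at0 (- (Q \Po (- 'X))).
  rewrite hornerN horner_comp !hornerE oppr0 oppr_ge0; apply => s s0.
  have := P0 (- s); rewrite -QsP hornerN horner_comp !hornerE mulrN -mulNr.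
  by rewrite pmulr_lge0.
have [T QT] := poly_factorX Q0.
split; first by rewrite PQ coefMX /= -horner_coef0.
rewrite PQ coefMX /= QT coefMX /= -horner_coef0; apply: horner_ge0_at0 => s s0.
have := P0 s; rewrite -QsP QT hornerM hornerX pmulr_lge0 // pmulr_lge0 //.
Qed.

End PolyNearZero.

Section HomogeneousParts.
Context {R : realType} {n : nat}.
Implicit Types (q : {mpoly R[n]}) (x : 'I_n -> R) (m : 'X_{1..n}).

Definition hpart k q x : R :=
  \sum_(m <- msupp q | mdeg m == k) q@_m * \prod_i x i ^+ m i.

(** On the line through [x], the coefficient of [s^k] in [q (s x)] is the part of degree [k] at
    [x]. *)
Lemma nonneg_hparts q x : Pos q -> q.@[fun=> 0] = 0 -> hpart 1 q x = 0 /\ 0 <= hpart 2 q x.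
Proof.
move=> q0 q00.
pose P : {poly R} := \sum_(m <- msupp q) (q@_m * \prod_i x i ^+ m i) *: 'X^(mdeg m).
have PE s : P.[s] = q.@[fun i => s * x i].
  rewrite horner_sum mevalE; apply: eq_bigr => m _.
  rewrite hornerZ hornerXn -mulrA; congr (_ * _).
  under [RHS]eq_bigr do rewrite exprMn.
  by rewrite big_split /= prodrXr -mdegE mulrC.
have Pk k : P`_k = hpart k q x.
  rewrite coef_sum /hpart [RHS]big_mkcond /=; apply: eq_bigr => m _.
  by rewrite coefZ coefXn eq_sym; case: eqP; rewrite ?mulr1 ?mulr0.
rewrite -!Pk; apply: nonneg_poly_coef => [s|]; first by rewrite PE; exact: q0.
by rewrite PE -[RHS]q00; apply: meval_eq => i; rewrite mul0r.
Qed.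

Lemma prod_delta_mnm1 i m : mdeg m = 1%N ->
  \prod_j ((j == i)%:R : R) ^+ m j = (m == U_(i)%MM)%:R.
Proof.
move=> /eqP/mdeg1P [j /eqP ->]; rewrite eq_mnm1 (bigD1 j) //= mnm1E eqxx expr1.
by rewrite big1 ?mulr1 // => k /negbTE kj; rewrite mnm1E [j == k]eq_sym kj expr0.
Qed.

Lemma nonneg_msupp_ge2 q m : Pos q -> q.@[fun=> 0] = 0 -> m \in msupp q -> (2 <= mdeg m)%N.
Proof.
move=> q0 q00 mq; rewrite ltnNge; apply/negP; rewrite leq_eqVlt ltnS leqn0 => /orP[m1|m0].
  have /mdeg1P [i /eqP mi] := m1.
  have [h _] := nonneg_hparts (fun j => (j == i)%:R) q0 q00.
  move: h; rewrite /hpart big_mkcond (bigD1_seq m) ?msupp_uniq //= m1.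
  rewrite prod_delta_mnm1 ?(eqP m1) // mi eqxx mulr1 big1 ?addr0.
    by move/eqP; rewrite mcoeff_eq0 -mi mq.
  move=> m' /negbTE ne; case: eqP => // d1.
  by rewrite prod_delta_mnm1 // ne mulr0.
move: q00; rewrite meval0E => /eqP; rewrite mcoeff_eq0.
by move: m0; rewrite mdeg_eq0 => /eqP <-; rewrite mq.
Qed.

Lemma mdeg2_mnm1D m : mdeg m = 2 -> exists i j, m = (U_(i) + U_(j))%MM.
Proof.
move=> m2; have [i mi] : exists i, m i != 0%N.
  apply/existsP; rewrite -negb_forall; apply/negP => /forallP h.
  move: m2; rewrite mdegE big1 // => i _; exact/eqP/h.
have e : m = (m - U_(i) + U_(i))%MM.
  rewrite submK //; apply/mnm_lepP => j; rewrite mnm1E.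
  by case: eqP => // <-; rewrite lt0n.
have : mdeg (m - U_(i))%MM = 1%N.
  by move: m2; rewrite e mdegD mdeg1 addn1 addmK => -[].
by move=> /eqP/mdeg1P [j /eqP jE]; exists j, i; rewrite {1}e jE.
Qed.

Lemma prod_mnm1D x i j : \prod_k x k ^+ (U_(i) + U_(j))%MM k = x i * x j.
Proof.
under eq_bigr do rewrite mnmDE exprD.
rewrite big_split /=; congr (_ * _).
  rewrite (bigD1 i) //= mnm1E eqxx expr1 big1 ?mulr1 // => k /negbTE ki.
  by rewrite mnm1E eq_sym ki expr0.
rewrite (bigD1 j) //= mnm1E eqxx expr1 big1 ?mulr1 // => k /negbTE ki.
by rewrite mnm1E eq_sym ki expr0.
Qed.

End HomogeneousParts.

Section LevyMeasure.
Local Open Scope classical_set_scope.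
Context {R : realType} {n : nat}.
Implicit Types (c : 'X_{1..n} -> R) (q : {mpoly R[n]}) (m al : 'X_{1..n}).

Lemma measurable_xpow al : measurable_fun [set: n.-tuple R] (xpow al : n.-tuple R -> R).
Proof.
apply: measurable_prod => i _; apply: measurable_funX.
exact: measurable_tnth.
Qed.

Lemma meval_xpow q (x : n.-tuple R) : q.@[tnth x] = \sum_(m <- msupp q) q@_m * xpow m x.
Proof. by []. Qed.

Variables (nu : {measure set (n.-tuple R) -> \bar R}).
Hypothesis nu_fin : forall al, (2 <= mdeg al)%N ->
  (\int[nu]_(x in [set: n.-tuple R]) `|xpow al x|%:E < +oo)%E.

Lemma integrable_xpow al : (2 <= mdeg al)%N ->
  nu.-integrable setT (fun x => (xpow al x)%:E).
Proof.
move=> al2; apply/integrableP; split; last exact: nu_fin.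
by apply/measurable_EFinP; exact: measurable_xpow.
Qed.

(** On the support of [q], all of degree at least two, [c] is a Gaussian term plus a moment of [nu].
    The first contributes values of the quadratic part of [q], the second the integral of [q]
    itself. *)
Lemma levy_conditionally_positive c (S : 'M[R]_n) : psd_sym S ->
  (forall i j, (c (U_(i) + U_(j))%MM)%:E
     = ((S i j)%:E + \int[nu]_(x in [set: n.-tuple R]) (xpow (U_(i) + U_(j))%MM x)%:E)%E) ->
  (forall al, (3 <= mdeg al)%N ->
     (c al)%:E = \int[nu]_(x in [set: n.-tuple R]) (xpow al x)%:E)%E ->
  conditionally_positive c.
Proof.
move=> /psd_sym_decomposition [s sE] c2 c3 q q0 q00.
pose I m := fine (\int[nu]_(x in [set: n.-tuple R]) (xpow m x)%:E)%E.
have IE m : (2 <= mdeg m)%N ->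
    (\int[nu]_(x in [set: n.-tuple R]) (xpow m x)%:E = (I m)%:E)%E.
  by move=> m2; rewrite fineK //; apply: integrable_fin_num => //; exact: integrable_xpow.
pose G m : R := if mdeg m == 2 then \sum_(v <- s) \prod_i v i ^+ m i else 0.
have cE m : (2 <= mdeg m)%N -> c m = G m + I m.
  move=> m2; apply: EFin_inj; rewrite EFinD -IE // /G.
  case: eqP => [/mdeg2_mnm1D [i [j ->]]|ne].
    by rewrite c2 sE; under [in RHS]eq_bigr do rewrite prod_mnm1D.
  by rewrite add0e c3 // ltn_neqAle m2 andbT eq_sym; apply/eqP.
have m2 m : m \in msupp q -> (2 <= mdeg m)%N by exact: nonneg_msupp_ge2.
have -> : mom c q = \sum_(v <- s) hpart 2 q v + \sum_(m <- msupp q) q@_m * I m.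
  rewrite /hpart; under eq_bigr do rewrite big_mkcond /=.
  rewrite exchange_big /= -big_split /= /mom big_seq [RHS]big_seq.
  apply: eq_bigr => m /m2 h; rewrite cE // mulrDr; congr (_ + _).
  rewrite /G; case: eqP => _; first by rewrite mulr_sumr.
  by rewrite mulr0 big1.
apply: addr_ge0; first by apply: sumr_ge0 => v _; exact: (nonneg_hparts v q0 q00).2.
rewrite -lee_fin.
have -> : ((\sum_(m <- msupp q) q@_m * I m)%:E =
    \int[nu]_(x in [set: n.-tuple R]) (q.@[tnth x])%:E)%E.
  (* Termwise integration asks for integrability at every index, not only at those in the support;
     hence the value [0] below degree two. *)
  pose f m (x : n.-tuple R) : \bar R :=
    if (2 <= mdeg m)%N then ((q@_m)%:E * (xpow m x)%:E)%E else 0%E.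
  transitivity (\int[nu]_(x in [set: n.-tuple R]) (\sum_(m <- msupp q) f m x)%E)%E; last first.
    apply: eq_integral => x _; rewrite meval_xpow -sumEFin big_seq [RHS]big_seq.
    by apply: eq_bigr => m /m2 h; rewrite /f h.
  rewrite integral_sum //; last first.
    move=> m; rewrite /f; have [h|h] := boolP (2 <= mdeg m)%N.
      by apply: integrableZl => //; exact: integrable_xpow.
    exact: integrable0.
  rewrite -sumEFin big_seq [RHS]big_seq; apply: eq_bigr => m /m2 h.
  rewrite /f h integralZl ?IE ?EFinM //; exact: integrable_xpow.
by apply: integral_ge0 => x _; rewrite lee_fin; exact: q0.
Qed.

End LevyMeasure.

(** * Linear minorants of sublinear functionals *)

Section SublinearMinorant.
Local Open Scope classical_set_scope.
Context {R : realType} {V : lmodType R} (E : set V).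
Hypothesis E_lin : forall (c : R) x y, E x -> E y -> E (c *: x + y).

(** Relative to [E] because the functional to be minorised is an infimum, meaningful only for
    dominated functions. *)
Definition sublinear_on (p : V -> R) :=
  (forall x y, E x -> E y -> p (x + y) <= p x + p y) /\
  (forall (c : R) x, 0 < c -> E x -> p (c *: x) = c * p x).

Let E0 x : E x -> E 0.
Proof. by move=> Ex; have := E_lin (-1) Ex Ex; rewrite scaleN1r addNr. Qed.

Let ED x y : E x -> E y -> E (x + y).
Proof. by move=> Ex Ey; have := E_lin 1 Ex Ey; rewrite scale1r. Qed.

Let EZ c x : E x -> E (c *: x).
Proof. by move=> Ex; have := E_lin c Ex (E0 Ex); rewrite addr0. Qed.

Let EN x : E x -> E (- x).
Proof. by move=> Ex; rewrite -scaleN1r; exact: EZ. Qed.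

Lemma sublinear_on0 p x : E x -> sublinear_on p -> p 0 = 0.
Proof.
move=> Ex [_ ph]; have := ph 2 0 ltac:(lra) (E0 Ex); rewrite scaler0; lra.
Qed.

Lemma sublinear_onN p x : sublinear_on p -> E x -> - p (- x) <= p x.
Proof.
move=> sp Ex; have [pD _] := sp; have := pD _ _ Ex (EN Ex).
by rewrite subrr (sublinear_on0 Ex sp); lra.
Qed.

Lemma sublinear_onZ p (c : R) x : sublinear_on p -> 0 <= c -> E x ->
  p (c *: x) = c * p x.
Proof.
move=> sp; rewrite le_eqVlt => /predU1P[<- Ex|c0 Ex].
  by rewrite scale0r mul0r (sublinear_on0 Ex sp).
by case: sp => _; apply.
Qed.

Let dominated (p : V -> R) (q : V -> R) :=
  sublinear_on q /\ forall x, E x -> q x <= p x.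

(** Zorn's lemma. A chain is bounded below by its pointwise infimum, which is finite since a
    sublinear [q <= p] satisfies [q x >= - p (- x)]; it is subadditive because the smaller of two
    members of a chain serves both arguments. *)
Lemma minimal_sublinear p : sublinear_on p -> exists q, dominated p q /\
  forall r, sublinear_on r -> (forall x, E x -> r x <= q x) ->
  forall x, E x -> q x <= r x.
Proof.
move=> sp.
pose T := {q : V -> R | dominated p q}.
pose L (q r : T) : bool := `[< forall x, E x -> sval r x <= sval q x >].
have t0 : T by exists p.
have [||A Atot|q qmin] := @ZL_preorder T t0 L.
- by move=> q; apply/asboolP.
- move=> q r s /asboolP qr /asboolP rs; apply/asboolP => x Ex.
  exact: le_trans (rs _ Ex) (qr _ Ex).
- have [[q0 Aq0]|A0] := pselect (A !=set0); last first.
    by exists t0 => s As; case: A0; exists s.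
  pose S x := [set sval q x | q in A].
  have Slb x : E x -> has_inf (S x).
    move=> Ex; split; first by exists (sval q0 x), q0.
    exists (- p (- x)) => _ [q Aq <-]; case: (svalP q) => sq qp.
    by rewrite (le_trans _ (sublinear_onN sq Ex)) // lerN2 qp //; exact: EN.
  have infP x q : E x -> A q -> inf (S x) <= sval q x.
    by move=> Ex Aq; apply: (ge_inf (Slb _ Ex).2); exists q.
  have infG x c : E x -> (forall q, A q -> c <= sval q x) -> c <= inf (S x).
    move=> Ex h; apply: lb_le_inf; first exact: (Slb _ Ex).1.
    by move=> _ [q Aq <-]; exact: h.
  have sq : dominated p (fun x => inf (S x)).
    split; last first.
      by move=> x Ex; rewrite (le_trans (infP _ _ Ex Aq0)) //; apply: (svalP q0).2.
    split=> [x y Ex Ey|c x c0 Ex].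
      rewrite -lerBlDr; apply: (infG _ _ _) => // q Aq; rewrite lerBlDr -lerBlDl.
      apply: (infG _ _ _) => // r Ar; rewrite lerBlDl.
      have [/asboolP qr|/asboolP rq] := Atot _ _ Aq Ar.
        have [[rD _] _] := svalP r.
        rewrite (le_trans (infP _ r (ED Ex Ey) Ar)) // (le_trans (rD _ _ Ex Ey)) //.
        by rewrite lerD2r; exact: qr.
      have [[rD _] _] := svalP q.
      rewrite (le_trans (infP _ q (ED Ex Ey) Aq)) // (le_trans (rD _ _ Ex Ey)) //.
      by rewrite lerD2l; exact: rq.
    apply/eqP; rewrite eq_le; apply/andP; split; last first.
      apply: (infG _ _ _) => [|q Aq]; first exact: EZ.
      have [[_ qh] _] := svalP q.
      by rewrite qh // ler_pM2l // infP.
    rewrite -ler_pdivrMl //; apply: (infG _ _ _) => // q Aq.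
    have [[_ qh] _] := svalP q.
    by rewrite ler_pdivrMl // -qh // infP //; exact: EZ.
  by exists (exist _ _ sq) => q Aq; apply/asboolP => x Ex; exact: infP.
exists (sval q); split; first exact: svalP.
move=> r sr rq x Ex.
have dr : dominated p r.
  split=> // z Ez; exact: le_trans (rq _ Ez) ((svalP q).2 _ Ez).
have := qmin (exist _ r dr) _.
by move=> h; apply: (asboolP _ (h _)) => //; apply/asboolP.
Qed.

(* Minimality of [q], tested against [x |-> inf_(s >= 0) (q (x + s y) - s q y)], forces [q] to be
   additive. *)
Lemma sublinear_linear_minorant p : sublinear_on p -> exists f : V -> R,
  [/\ forall x y, E x -> E y -> f (x + y) = f x + f y,
      forall (c : R) x, E x -> f (c *: x) = c * f x &
      forall x, E x -> f x <= p x].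
Proof.
move=> /minimal_sublinear [q [[sq qp] qmin]].
have [qD qh] := sq.
have qadd x y : E x -> E y -> q (x + y) = q x + q y.
  move=> Ex Ey; apply/eqP; rewrite eq_le qD //= addrC.
  pose S z := [set q (z + s *: y) - s * q y | s in [set s : R | 0 <= s]].
  have Slb z : E z -> has_inf (S z).
    move=> Ez; split; first by exists (q (z + 0 *: y) - 0 * q y), 0 => //=.
    exists (- q (- z)) => _ [s /= s0 <-].
    have := qD _ _ (ED Ez (EZ s Ey)) (EN Ez).
    by rewrite addrAC subrr add0r sublinear_onZ //; lra.
  have infP z (s : R) : E z -> 0 <= s -> inf (S z) <= q (z + s *: y) - s * q y.
    by move=> Ez s0; apply: (ge_inf (Slb _ Ez).2); exists s.
  have infG z (c : R) : E z -> (forall s : R, 0 <= s -> c <= q (z + s *: y) - s * q y) ->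
      c <= inf (S z).
    move=> Ez h; apply: lb_le_inf; first exact: (Slb _ Ez).1.
    by move=> _ [s s0 <-]; exact: h.
  have sr : sublinear_on (fun z => inf (S z)).
    split=> [z w Ez Ew|c z c0 Ez].
      rewrite -lerBlDr; apply: (infG _ _ _) => // s s0; rewrite lerBlDr -lerBlDl.
      apply: (infG _ _ _) => // t t0; rewrite lerBlDl.
      rewrite (le_trans (infP _ (s + t) (ED Ez Ew) (addr_ge0 s0 t0))) //.
      have := qD _ _ (ED Ez (EZ s Ey)) (ED Ew (EZ t Ey)).
      by rewrite addrACA -scalerDl mulrDl; lra.
    apply/eqP; rewrite eq_le; apply/andP; split; last first.
      apply: (infG _ _ _) => [|s s0]; first exact: EZ.
      have c1 : 0 <= s / c by rewrite divr_ge0 // ltW.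
      have := infP _ _ Ez c1; rewrite -(ler_pM2l c0) => /le_trans; apply.
      rewrite mulrBr -(qh _ _ c0 (ED Ez (EZ (s / c) Ey))).
      have e : c * (s / c) = s by rewrite mulrC divfK // gt_eqF.
      by rewrite mulrA scalerDr scalerA e.
    rewrite -ler_pdivrMl //; apply: (infG _ _ _) => // s s0.
    rewrite ler_pdivrMl //.
    have c1 : 0 <= c * s by rewrite mulr_ge0 // ltW.
    rewrite (le_trans (infP _ _ (EZ c Ez) c1)) // mulrBr -(qh _ _ c0 (ED Ez (EZ s Ey))).
    by rewrite scalerDr scalerA mulrA.
  have rq z : E z -> inf (S z) <= q z.
    by move=> Ez; have := infP _ 0 Ez (lexx _); rewrite scale0r addr0 mul0r subr0.
  have := qmin _ sr rq x Ex; have := infP _ 1 Ex ler01.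
  by rewrite scale1r mul1r; lra.
have qN x : E x -> q (- x) = - q x.
  move=> Ex; have := qadd _ _ Ex (EN Ex); rewrite subrr (sublinear_on0 Ex sq).
  by lra.
exists q; split=> // c x Ex; have [c0|c0] := leP 0 c.
  by rewrite sublinear_onZ.
have c1 : 0 <= - c by lra.
have := sublinear_onZ sq c1 Ex; rewrite scaleNr qN; last exact: EZ.
by lra.
Qed.

End SublinearMinorant.

(** * Measures from positive functionals on bounded maps *)

Section BitPaths.
Local Open Scope classical_set_scope.
Context {R : realType} {S : Type}.
Implicit Types (f g : S -> R) (u : R) (s l : seq bool) (k : nat).

Definition bounded_map (T : Type) (f : T -> R) := exists C : R, forall x, `|f x| <= C.

Variable M : (S -> R) -> R.
Hypothesis M_lin : forall (c : R) f g, bounded_map f -> bounded_map g ->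
  M (fun x => c * f x + g x) = c * M f + M g.
Hypothesis M_ge0 : forall f, bounded_map f -> (forall x, 0 <= f x) -> 0 <= M f.

Lemma bounded_map_cst (T : Type) (c : R) : @bounded_map T (fun=> c).
Proof. by exists `|c|. Qed.

Lemma bounded_map_lin (T : Type) (c : R) (f g : T -> R) : bounded_map f -> bounded_map g ->
  bounded_map (fun x => c * f x + g x).
Proof.
move=> [C hC] [D hD]; exists (`|c| * C + D) => x.
by rewrite (le_trans (ler_normD _ _)) // normrM lerD // ler_wpM2l.
Qed.

Lemma bounded_map_sum (T I : Type) (r : seq I) (c : I -> R) (F : I -> T -> R) :
  (forall i, bounded_map (F i)) -> bounded_map (fun x => \sum_(i <- r) c i * F i x).
Proof.
move=> bF; elim: r => [|i r IH].
  by exists 0 => x; rewrite big_nil normr0.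
have := bounded_map_lin (c i) (bF i) IH.
by move=> [C hC]; exists C => x; rewrite big_cons.
Qed.

Lemma functional0 : M (fun=> 0) = 0.
Proof.
have b0 := @bounded_map_cst S 0.
by have := M_lin 1 b0 b0; rewrite !mul1r addr0; lra.
Qed.

Lemma functional_sum (I : Type) (r : seq I) (c : I -> R) (F : I -> S -> R) :
  (forall i, bounded_map (F i)) ->
  M (fun x => \sum_(i <- r) c i * F i x) = \sum_(i <- r) c i * M (F i).
Proof.
move=> bF; elim: r => [|i r IH].
  rewrite big_nil -[RHS]functional0; congr M; apply/funext => x.
  by rewrite big_nil.
rewrite big_cons -IH -M_lin //; last exact: bounded_map_sum.
by congr M; apply/funext => x; rewrite big_cons.
Qed.

Lemma functional_le f g : bounded_map f -> bounded_map g -> (forall x, f x <= g x) -> M f <= M g.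
Proof.
move=> bf bg fg; have := M_ge0 (bounded_map_lin (-1) bf bg).
rewrite M_lin // => /(_ _); rewrite mulN1r addrC subr_ge0; apply => x.
by rewrite mulN1r addrC subr_ge0.
Qed.

Definition mass : R := M (fun=> 1).

Lemma functional_cst c : M (fun=> c) = c * mass.
Proof.
have := M_lin c (@bounded_map_cst S 1) (@bounded_map_cst S 0); by rewrite functional0 !addr0 mulr1.
Qed.

Lemma mass_ge0 : 0 <= mass.
Proof. by apply: M_ge0 => //; exact: bounded_map_cst. Qed.

Lemma functional_dist f g e : bounded_map f -> bounded_map g -> (forall x, `|f x - g x| <= e) ->
  `|M f - M g| <= e * mass.
Proof.
move=> bf bg fg; have be := @bounded_map_cst S e; have bN := @bounded_map_cst S (- e).
have fg' x : - e <= f x - g x <= e by rewrite -ler_norml.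
have h1 : M f <= M (fun x => 1 * g x + e).
  apply: functional_le => // [|x]; first exact: bounded_map_lin.
  by have := fg' x; lra.
have h2 : M (fun x => 1 * g x + - e) <= M f.
  apply: functional_le => // [|x]; first exact: bounded_map_lin.
  by have := fg' x; lra.
move: h1 h2; rewrite !M_lin // !functional_cst mulNr ler_norml; lra.
Qed.

Variable b : S -> nat -> bool.

(** The mass of the cell of points whose digits begin with [s]. Its indicator is in general
    discontinuous, so [M] has to act on all bounded maps. *)
Definition weight s : R := M (fun x => (mkseq (b x) (size s) == s)%:R).

Lemma bounded_map_bool (T : Type) (p : T -> bool) : bounded_map (fun x => (p x)%:R).
Proof. by exists 1 => x; case: (p x); rewrite ?normr1 ?normr0 ?ler01 ?lexx. Qed.

Lemma weight_ge0 s : 0 <= weight s.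
Proof. by apply: M_ge0 => //; exact: bounded_map_bool. Qed.

Lemma weight_nil : weight [::] = mass.
Proof. by []. Qed.

Lemma mkseq_rcons (T : Type) (h : nat -> T) k : mkseq h k.+1 = rcons (mkseq h k) (h k).
Proof. by rewrite /mkseq -addn1 iotaD map_cat /= add0n cats1. Qed.

Lemma weight_rcons s : weight s = weight (rcons s false) + weight (rcons s true).
Proof.
rewrite -[weight (rcons s false)]mul1r -M_lin; try exact: bounded_map_bool.
congr M; apply/funext => x; rewrite !size_rcons mkseq_rcons !eqseq_rcons mul1r.
by case: (_ == s); case: (b x _); rewrite /= ?addr0 ?add0r.
Qed.

(** Words grow at their right end, so the recursion runs on the reversed word. A digit [true] adds
    the weight of the left sibling: cells of equal length are laid out on [[0, mass[] in
    lexicographic order. *)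
Fixpoint path_left (r : seq bool) : R :=
  if r is c :: r' then path_left r' + (if c then weight (rev (false :: r')) else 0) else 0.

Definition left_end s := path_left (rev s).

Lemma left_end_rcons s (c : bool) :
  left_end (rcons s c) = left_end s + (if c then weight (rcons s false) else 0).
Proof. by rewrite /left_end rev_rcons /= rev_cons revK. Qed.

(** A quantile transform: at each level [u] enters the child interval containing it, so that every
    word is produced on a set whose length is its weight. *)
Fixpoint bit_path u k : seq bool :=
  if k is k'.+1 then
    let s := bit_path u k' in rcons s (left_end s + weight (rcons s false) <= u)
  else [::].

Definition bit u k : bool :=
  left_end (bit_path u k) + weight (rcons (bit_path u k) false) <= u.

Lemma mkseq_bit u k : mkseq (bit u) k = bit_path u k.
Proof. by elim: k => //= k IH; rewrite mkseq_rcons IH. Qed.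

Lemma bit_path_mem u k : 0 <= u < mass ->
  left_end (bit_path u k) <= u < left_end (bit_path u k) + weight (bit_path u k).
Proof.
move=> u0; elim: k => [|k] /=; first by rewrite /left_end /= weight_nil add0r.
set s := bit_path u k => /andP[h1 h2].
rewrite left_end_rcons; case: (leP (left_end s + weight (rcons s false)) u) => h.
  by rewrite h -addrA -weight_rcons h2.
by rewrite addr0 h1 h.
Qed.

Lemma bit_pathP u s : 0 <= u < mass ->
  (bit_path u (size s) == s) = (left_end s <= u < left_end s + weight s).
Proof.
move=> u0; apply/eqP/idP => [E|]; first by have := bit_path_mem (size s) u0; rewrite E.
elim/last_ind: s => //= s c IH; rewrite size_rcons /= left_end_rcons => h.
have E : bit_path u (size s) = s.
  apply: IH; have w0 := weight_ge0 (rcons s false); have w1 := weight_ge0 (rcons s true).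
  by case: c h; rewrite (weight_rcons s) => /andP[? ?]; apply/andP; split; lra.
rewrite E; congr rcons.
by case: c h => /andP[h1 h2]; rewrite ?h1 //; apply/negbTE; rewrite -ltNge; move: h2; rewrite addr0.
Qed.

(* Lebesgue measure, up to the identification of [measurableTypeR R] with [R]. *)
Variable mu : {measure set R -> \bar R}.
Hypothesis mu_itv : forall x y : R, x <= y -> mu `[x, y[%classic = (y - x)%:E.
Let D : set R := `[0, mass[.

Lemma measurable_dom : measurable D. Proof. exact: measurable_itv. Qed.

Lemma left_end_bounds s : 0 <= left_end s /\ left_end s + weight s <= mass.
Proof.
elim/last_ind: s => [|s c [IH1 IH2]]; first by rewrite /left_end /= weight_nil add0r.
have w0 := weight_ge0 (rcons s false); have w1 := weight_ge0 (rcons s true).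
by rewrite left_end_rcons; move: IH2; rewrite weight_rcons; case: c; split; lra.
Qed.

Lemma bit_path_preimage s : D `&` [set u | bit_path u (size s) == s] =
  `[left_end s, left_end s + weight s[.
Proof.
have [l0 l1] := left_end_bounds s.
apply/seteqP; split => u /=; rewrite !in_itv /=.
  by move=> [u0]; rewrite bit_pathP.
move=> /andP[u0 u1].
have h : 0 <= u < mass by apply/andP; split; lra.
by split => //; rewrite bit_pathP // u0.
Qed.

Lemma sum_tuples_indicator k (F : seq bool -> R) (h : nat -> bool) :
  F (mkseq h k) = \sum_(t : k.-tuple bool) F t * (mkseq h (size t) == t)%:R.
Proof.
have hk : size (mkseq h k) == k by rewrite size_mkseq.
rewrite (bigD1 (Tuple hk)) //= size_mkseq eqxx mulr1 big1 ?addr0 // => t ne.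
rewrite size_tuple; case: eqP => E; last by rewrite mulr0.
by move: ne; rewrite -val_eqE /= E eqxx.
Qed.

Lemma functional_prefix k (F : seq bool -> R) :
  M (fun x => F (mkseq (b x) k)) = \sum_(t : k.-tuple bool) F t * weight t.
Proof.
rewrite -functional_sum; last by move=> t; exact: bounded_map_bool.
by congr M; apply/funext => x; exact: sum_tuples_indicator.
Qed.

Lemma measure_dom : mu D = mass%:E.
Proof. by rewrite /D mu_itv ?subr0 ?mass_ge0. Qed.

Let finD : (mu D < +oo)%E. Proof. by rewrite measure_dom ltry. Qed.

Let I s : set R := `[left_end s, left_end s + weight s[.

Let mI s : measurable (I s). Proof. exact: measurable_itv. Qed.

Let mkseq_bit_indic k (F : seq bool -> R) u : D u ->
  F (mkseq (bit u) k) = \sum_(t : k.-tuple bool) F t * \1_(I t) u.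
Proof.
rewrite /D /= in_itv /= => u0; rewrite sum_tuples_indicator; apply: eq_bigr => t _.
rewrite mkseq_bit bit_pathP // indicE; congr (_ * (_ : bool)%:R).
by apply/idP/idP; rewrite inE /I /= in_itv.
Qed.

Lemma measurable_prefix k (F : seq bool -> R) :
  measurable_fun D (fun u => F (mkseq (bit u) k)).
Proof.
apply: (@eq_measurable_fun _ _ _ _ D (fun u => \sum_(t : k.-tuple bool) F t * \1_(I t) u)).
  by move=> u; rewrite inE => /mkseq_bit_indic ->.
apply: measurable_sum => t; apply: measurable_funM => //.
Qed.

Let mu_I s : mu (I s `&` D) = (weight s)%:E.
Proof.
have <- : I s = I s `&` D.
  by rewrite /I -bit_path_preimage setIAC setIid.
by rewrite /I mu_itv ?lerDl ?weight_ge0 // addrAC subrr add0r.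
Qed.

(** A function of [k] digits is a finite combination of cell indicators, so finite additivity of [M]
    is enough. *)
Lemma integral_prefix k (F : seq bool -> R) :
  (\int[mu]_(u in D) (F (mkseq (bit u) k))%:E)%E = (M (fun x => F (mkseq (b x) k)))%:E.
Proof.
rewrite functional_prefix.
transitivity (\int[mu]_(u in D) (\sum_(t : k.-tuple bool) (F t)%:E * (\1_(I t) u)%:E)%E)%E.
  apply: eq_integral => u; rewrite inE => /mkseq_bit_indic ->.
  by rewrite -sumEFin.
have ii t : mu.-integrable D (fun u => (\1_(I t) u)%:E).
  apply: (@measurable_bounded_integrable _ _ _ mu (\1_(I t)) D) => //.
    exact: measurable_dom.
  exists 1; split; [exact: num_real|move=> c c1 u _ /=].
  by rewrite indicE; case: (_ \in _); rewrite ?normr1 ?normr0 ltW // (lt_trans ltr01).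
rewrite integral_sum; [|exact: measurable_dom|by move=> t; apply: integrableZl => //; exact: measurable_dom].
rewrite -sumEFin; apply: eq_bigr => t _.
by rewrite (integralZl measurable_dom (ii t)) (integral_indic _ measurable_dom (mI t)) mu_I EFinM.
Qed.

(** Uniform continuity on the Cantor space: such a [P] is a uniform limit of functions of finite
    prefixes, padded with [false]. *)
Definition cantor_continuous (P : (nat -> bool) -> R) := forall e : R, 0 < e ->
  exists k, forall s t : nat -> bool, mkseq s k = mkseq t k -> `|P s - P t| <= e.

Let pad (l : seq bool) : nat -> bool := nth false l.

Let mkseq_pad (h : nat -> bool) k : mkseq (pad (mkseq h k)) k = mkseq h k.
Proof.
apply: (@eq_from_nth _ false); rewrite !size_mkseq // => i ik.
by rewrite nth_mkseq.
Qed.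

Lemma cantor_continuous_bounded P : cantor_continuous P -> bounded_map P.
Proof.
move=> /(_ 1 ltr01) [k hk].
exists (1 + \sum_(t : k.-tuple bool) `|P (pad t)|) => h.
have := hk h (pad (mkseq h k)); rewrite mkseq_pad => /(_ erefl) le1.
have -> : P h = (P h - P (pad (mkseq h k))) + P (pad (mkseq h k)) by rewrite subrK.
rewrite (le_trans (ler_normD _ _)) // lerD //.
have hs : size (mkseq h k) == k by rewrite size_mkseq.
by rewrite (bigD1 (Tuple hs)) //= lerDl; apply: sumr_ge0.
Qed.

Let cvg_prefix P h : cantor_continuous P -> P (pad (mkseq h k)) @[k --> \oo] --> P h.
Proof.
move=> cP; apply/cvgrPdist_le => e /cP [k hk].
exists k => // j /= kj; apply: hk.
by apply: (@eq_from_nth _ false); rewrite !size_mkseq // => i ik;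
  rewrite !nth_mkseq // /pad nth_mkseq // (leq_trans ik).
Qed.

Lemma measurable_cantor P : cantor_continuous P -> measurable_fun D (fun u => P (bit u)).
Proof.
move=> cP; apply: (@measurable_fun_cvg _ _ _ D (fun k u => P (pad (mkseq (bit u) k)))).
  move=> k; exact: (measurable_prefix _ (P \o pad)).
by move=> u Du; exact: cvg_prefix.
Qed.

Lemma integrable_cantor P : cantor_continuous P ->
  mu.-integrable D (fun u => (P (bit u))%:E).
Proof.
move=> cP; apply: (@measurable_bounded_integrable _ _ _ mu (fun u => P (bit u)) D) => //.
- exact: measurable_dom.
- exact: measurable_cantor.
have [C hC] := cantor_continuous_bounded cP.
by exists C; split; [exact: num_real|move=> c Cc u _; exact: le_trans (hC _) (ltW Cc)].
Qed.

(** The prefix length tends to infinity. Dominated convergence handles the integral; [M] has no such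
    theorem, and there the approximation must be uniform. *)
Lemma integral_cantor P : cantor_continuous P ->
  (\int[mu]_(u in D) (P (bit u))%:E)%E = (M (fun x => P (b x)))%:E.
Proof.
move=> cP; have iP := integrable_cantor cP.
have [C hC] := cantor_continuous_bounded cP.
have bP : bounded_map (fun x => P (b x)) by exists C.
have : (fun k => \int[mu]_(u in D) (P (pad (mkseq (bit u) k)))%:E)%E @ \oo -->
    (\int[mu]_(u in D) (P (bit u))%:E)%E.
  have mf k : measurable_fun D (fun u => (P (pad (mkseq (bit u) k)))%:E).
    by apply/measurable_EFinP; exact: (measurable_prefix _ (P \o pad)).
  have mP : measurable_fun D (fun u => (P (bit u))%:E).
    by apply/measurable_EFinP; exact: measurable_cantor.
  have [] := @dominated_convergence _ _ R mu D measurable_dom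
    (fun k u => (P (pad (mkseq (bit u) k)))%:E) (fun u => (P (bit u))%:E)
    (fun=> C%:E) mf mP => //.
  - apply: aeW => u Du; apply: cvg_EFin; first exact: nearW.
    exact: cvg_prefix.
  - apply: (@measurable_bounded_integrable _ _ _ mu (cst C) D) => //.
      exact: measurable_dom.
    exists `|C|; split; [exact: num_real|move=> c Cc u _; exact: ltW].
  - by apply: aeW => u Du k; rewrite lee_fin.
under eq_cvg do rewrite (integral_prefix _ (P \o pad)).
move=> /(cvg_unique (@ereal_hausdorff R)); apply.
apply: cvg_EFin; first exact: nearW.
apply/cvgrPdist_le => e e0.
(* The mass may be zero, hence the added [1]. *)
have m1 : 0 < mass + 1 by have := mass_ge0; lra.
have [k hk] := cP (e / (mass + 1)) (divr_gt0 e0 m1).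
exists k => // j /= kj.
have bj : bounded_map (fun x => P (pad (mkseq (b x) j))) by exists C.
apply: le_trans (functional_dist (e := e / (mass + 1)) bP bj _) _.
  move=> x; apply: hk; apply: (@eq_from_nth _ false); rewrite !size_mkseq // => i ik.
  by rewrite !nth_mkseq // /pad nth_mkseq // (leq_trans ik).
rewrite mulrAC ler_pdivrMr // ler_pM2l //; lra.
Qed.

End BitPaths.

(** * Binary expansions in the closed unit interval *)

Section BinaryDigits.
Local Open Scope classical_set_scope.
Context {R : realType}.
Implicit Types (s : nat -> bool) (x : R) (j k : nat).

(** The doubling map. A remainder equal to [1] reproduces itself, so the endpoint [1] gets the
    expansion with all digits [true]. *)
Fixpoint binary_rem x j : R :=
  if j is j'.+1 then
    let y := binary_rem x j' in 2 * y - (if 2^-1 <= y then 1 else 0) else x.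

Definition binary_digit x j : bool := 2^-1 <= binary_rem x j.

Definition binary_part s k : R := \sum_(j < k) (s j)%:R / 2 ^+ j.+1.

Definition binary_value s : R := limn (binary_part s).

Lemma binary_partS s k : binary_part s k.+1 = binary_part s k + (s k)%:R / 2 ^+ k.+1.
Proof. by rewrite /binary_part big_ord_recr. Qed.

Lemma pow2_gt0 k : 0 < 2 ^+ k :> R. Proof. by rewrite exprn_gt0. Qed.

Lemma binary_rem_bounds x k : 0 <= x <= 1 -> 0 <= binary_rem x k <= 1.
Proof.
move=> x01; elim: k => //= k; set y := binary_rem x k.
by case: (leP 2^-1 y) => h /andP[y0 y1] /=; apply/andP; split; lra.
Qed.

Lemma binary_part_rem x k :
  x = binary_part (binary_digit x) k + binary_rem x k / 2 ^+ k.
Proof.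
elim: k => [|k IH]; first by rewrite /binary_part big_ord0 add0r expr0 divr1.
rewrite binary_partS [LHS]IH /= /binary_digit exprS.
case: (2^-1 <= binary_rem x k) => /=; rewrite ?mul0r ?subr0 ?addr0;
  have := pow2_gt0 k; move: (2 ^+ k) => y y0; field; by rewrite gt_eqF.
Qed.

Lemma binary_part_le s k j : binary_part s k <= binary_part s (k + j).
Proof.
elim: j => [|j IH]; first by rewrite addn0.
by rewrite addnS binary_partS (le_trans IH) // lerDl divr_ge0 // ltW // pow2_gt0.
Qed.

(** Keeping the exact remainder of the geometric series lets the induction close. *)
Lemma binary_part_tail s k j :
  binary_part s (k + j) <= binary_part s k + (2 ^+ k)^-1 - (2 ^+ (k + j))^-1.
Proof.
elim: j => [|j IH]; first by rewrite addn0; lra.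
rewrite addnS binary_partS.
have h : (s (k + j)%N)%:R / 2 ^+ (k + j).+1 <= (2 ^+ (k + j))^-1 - (2 ^+ (k + j).+1)^-1 :> R.
  rewrite exprS; have := pow2_gt0 (k + j); move: (2 ^+ _) => y y0.
  have -> : y^-1 - (2 * y)^-1 = (2 * y)^-1 by field; rewrite gt_eqF.
  case: (s _) => /=; rewrite ?mul1r ?mul0r ?lexx //.
  by rewrite invr_ge0 mulr_ge0 // ltW.
by move: IH h; lra.
Qed.

Lemma cvg_binary_part s : cvgn (binary_part s).
Proof.
apply: nondecreasing_is_cvgn.
  by move=> i j ij; rewrite -(subnKC ij) binary_part_le.
exists 1 => _ [k _ <-]; have := binary_part_tail s 0 k.
rewrite add0n {2}/binary_part big_ord0 expr0 invr1 => h.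
have : 0 <= (2 ^+ k)^-1 :> R by rewrite invr_ge0 ltW // pow2_gt0.
by move: h; lra.
Qed.

Lemma binary_value_dist s k :
  binary_part s k <= binary_value s <= binary_part s k + (2 ^+ k)^-1.
Proof.
apply/andP; split.
  apply: limr_ge; first exact: cvg_binary_part.
  by exists k => // j /= kj; rewrite -(subnKC kj) binary_part_le.
apply: limr_le; first exact: cvg_binary_part.
exists k => // j /= kj; rewrite -(subnKC kj) (le_trans (binary_part_tail _ _ _)) //.
by rewrite lerBlDr lerDl invr_ge0 ltW // pow2_gt0.
Qed.

Lemma binary_value_bounds s : 0 <= binary_value s <= 1.
Proof.
have := binary_value_dist s 0; rewrite /binary_part big_ord0 expr0 invr1 add0r.
by [].
Qed.

Lemma pow2_inv_small (e : R) : 0 < e -> exists k, (2 ^+ k)^-1 <= e.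
Proof.
move=> e0; pose k := Num.bound e^-1.
have h : e^-1 < k%:R by apply: archi_boundP; rewrite invr_ge0 ltW.
exists k; rewrite -[leRHS]invrK lef_pV2 ?posrE ?pow2_gt0 ?invr_gt0 //.
by rewrite (le_trans (ltW h)) // -natrX ler_nat ltnW // ltn_expl.
Qed.

Lemma binary_value_digit x : 0 <= x <= 1 -> binary_value (binary_digit x) = x.
Proof.
move=> x01; apply/eqP; rewrite -subr_eq0 -normr_le0; apply/ler_addgt0Pl => e e0.
have [k hk] := pow2_inv_small e0; rewrite addr0 (le_trans _ hk) //.
have /andP[h1 h2] := binary_value_dist (binary_digit x) k.
have hx := binary_part_rem x k.
have /andP[r0 r1] := binary_rem_bounds k x01.
have p0 : 0 < (2 ^+ k)^-1 :> R by rewrite invr_gt0 pow2_gt0.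
have q0 : 0 <= binary_rem x k / 2 ^+ k by rewrite mulr_ge0 // ltW.
have q1 : binary_rem x k / 2 ^+ k <= (2 ^+ k)^-1 by rewrite ler_piMl // ltW.
by rewrite ler_norml; apply/andP; split; lra.
Qed.

End BinaryDigits.

(** * Lipschitz functions on a cube *)

Section CubeLipschitz.
Context {R : realType} {I : finType}.
Implicit Types (x y : I -> R) (P Q : (I -> R) -> R).

Definition in_cube x := forall i, 0 <= x i <= 1.

Definition cube_lipschitz P := exists L : R, 0 <= L /\
  forall x y, in_cube x -> in_cube y -> `|P x - P y| <= L * \sum_i `|x i - y i|.

Lemma cube_lipschitz_bounded P : cube_lipschitz P ->
  exists C : R, 0 <= C /\ forall x, in_cube x -> `|P x| <= C.
Proof.
move=> [L [L0 hL]]; exists (`|P (fun=> 0)| + L * #|I|%:R); split.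
  by rewrite addr_ge0 // mulr_ge0.
move=> x cx; have c0 : in_cube (fun=> 0 : R) by move=> i; rewrite lexx ler01.
have -> : P x = P (fun=> 0) + (P x - P (fun=> 0)) by rewrite addrC subrK.
rewrite (le_trans (ler_normD _ _)) // lerD2l (le_trans (hL _ _ cx c0)) //.
apply: ler_wpM2l => //; rewrite -sumr_const; apply: ler_sum => i _.
by rewrite subr0 ger0_norm; case/andP: (cx i).
Qed.

Lemma cube_lipschitz_cst (c : R) : cube_lipschitz (fun=> c).
Proof. by exists 0; split=> // x y _ _; rewrite subrr normr0 mul0r. Qed.

Lemma cube_lipschitz_coord (h : R -> R) (L : R) i :
  0 <= L -> (forall s t, 0 <= s <= 1 -> 0 <= t <= 1 -> `|h s - h t| <= L * `|s - t|) ->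
  cube_lipschitz (fun x => h (x i)).
Proof.
move=> L0 hL; exists L; split=> // x y cx cy.
rewrite (le_trans (hL _ _ (cx i) (cy i))) // ler_wpM2l // (bigD1 i) //= lerDl.
by apply: sumr_ge0.
Qed.

Lemma cube_lipschitzM P Q : cube_lipschitz P -> cube_lipschitz Q ->
  cube_lipschitz (fun x => P x * Q x).
Proof.
move=> lP lQ; have [C [C0 hC]] := cube_lipschitz_bounded lP.
have [D [D0 hD]] := cube_lipschitz_bounded lQ.
have [L [L0 hL]] := lP; have [K [K0 hK]] := lQ.
exists (D * L + C * K); split; first by rewrite addr_ge0 // mulr_ge0.
move=> x y cx cy; set T := \sum_i _.
have -> : P x * Q x - P y * Q y = (P x - P y) * Q x + P y * (Q x - Q y) by ring.
rewrite (le_trans (ler_normD _ _)) // !normrM mulrDl lerD //.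
  rewrite mulrC -mulrA; apply: ler_pM => //; first exact: hD.
  exact: hL.
by rewrite -mulrA; apply: ler_pM => //; [exact: hC|exact: hK].
Qed.

Lemma cube_lipschitzX P k : cube_lipschitz P -> cube_lipschitz (fun x => P x ^+ k).
Proof.
move=> lP; elim: k => [|k IH].
  by under [X in cube_lipschitz X]funext do rewrite expr0; exact: cube_lipschitz_cst.
under [X in cube_lipschitz X]funext do rewrite exprS.
exact: cube_lipschitzM.
Qed.

Lemma cube_lipschitz_prod (J : Type) (r : seq J) (F : J -> (I -> R) -> R) :
  (forall j, cube_lipschitz (F j)) -> cube_lipschitz (fun x => \prod_(j <- r) F j x).
Proof.
move=> lF; elim: r => [|j r IH].
  by under [X in cube_lipschitz X]funext do rewrite big_nil; exact: cube_lipschitz_cst.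
under [X in cube_lipschitz X]funext do rewrite big_cons.
exact: cube_lipschitzM.
Qed.

End CubeLipschitz.

Section Coupling.
Local Open Scope classical_set_scope.
Context {R : realType} {S : Type} {I : finType}.
Variable M : (S -> R) -> R.
Hypothesis M_lin : forall (c : R) f g, bounded_map f -> bounded_map g ->
  M (fun x => c * f x + g x) = c * M f + M g.
Hypothesis M_ge0 : forall f, bounded_map f -> (forall x, 0 <= f x) -> 0 <= M f.
Variable g : S -> I -> R.
Hypothesis g_cube : forall x, in_cube (g x).

(** The digits of all coordinates are merged into one word through [pickle]. Continuity is needed of
    [decode] only; [encode] jumps at dyadic points but enters only through [M]. *)
Let decode (s : nat -> bool) (i : I) : R := binary_value (fun j => s (pickle (i, j))).

Let encode (x : I -> R) (k : nat) : bool :=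
  if unpickle k is Some (i, j) then binary_digit (x i) j else false.

Let decode_encode x : in_cube x -> decode (encode x) = x.
Proof.
move=> cx; apply/funext => i; rewrite /decode -[RHS]binary_value_digit //.
by congr binary_value; apply/funext => j; rewrite /encode pickleK.
Qed.

Let decode_cube s : in_cube (decode s).
Proof. by move=> i; exact: binary_value_bounds. Qed.

Let decode_close (e : R) : 0 < e -> exists k, forall s t, mkseq s k = mkseq t k ->
  forall i, `|decode s i - decode t i| <= e.
Proof.
move=> e0; have [j hj] := pow2_inv_small e0.
(* Long enough to contain the codes of the first [j] digits of every coordinate. *)
exists (\max_(i : I) \max_(l < j) (pickle (i, l : nat)).+1)%N => s t st i.
have E : binary_part (fun l => s (pickle (i, l))) j = binary_part (fun l => t (pickle (i, l))) j :> R.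
  apply: eq_bigr => l _; congr ((nat_of_bool _)%:R / _).
  set k := (\max_i _)%N in st.
  have lk : (pickle (i, l : nat) < k)%N.
    apply: leq_trans (leq_bigmax i); exact: (leq_bigmax l).
  by rewrite -(nth_mkseq false s lk) st nth_mkseq.
have /andP[h1 h2] := @binary_value_dist R (fun l => s (pickle (i, l))) j.
have /andP[h3 h4] := @binary_value_dist R (fun l => t (pickle (i, l))) j.
rewrite (le_trans _ hj) // /decode ler_norml; move: h1 h2; rewrite E => h1 h2.
by apply/andP; split; lra.
Qed.

Let cantor_decode P : cube_lipschitz P -> cantor_continuous (fun s => P (decode s)).
Proof.
move=> [L [L0 hL]] e e0.
have K0 : 0 < L * #|I|%:R + 1 by rewrite ltr_wpDl // mulr_ge0.
have [k hk] := decode_close (divr_gt0 e0 K0); exists k => s t /hk h.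
rewrite (le_trans (hL _ _ (decode_cube s) (decode_cube t))) //.
apply: (@le_trans _ _ (L * (#|I|%:R * (e / (L * #|I|%:R + 1))))).
  apply: ler_wpM2l => //; rewrite mulr_natl -sumr_const; exact: ler_sum.
rewrite !mulrA ler_pdivrMr // mulrC ler_pM2l //; lra.
Qed.

Variable mu : {measure set R -> \bar R}.
Hypothesis mu_itv : forall x y : R, x <= y -> mu `[x, y[%classic = (y - x)%:E.

(** The law of [G] under length on [[0, mass M[] is the measure representing [M] composed with [g]
    on Lipschitz functions of the cube. *)
Lemma positive_functional_coupling : exists G : R -> I -> R,
  [/\ forall u, in_cube (G u),
      forall i, measurable_fun `[0, mass M[ (fun u => G u i),
      forall P, cube_lipschitz P -> mu.-integrable `[0, mass M[ (fun u => (P (G u))%:E) &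
      forall P, cube_lipschitz P ->
        (\int[mu]_(u in `[0%R, mass M[) (P (G u))%:E)%E = (M (fun x => P (g x)))%:E].
Proof.
pose b x := encode (g x).
exists (fun u => decode (bit M b u)); split.
- by move=> u; exact: decode_cube.
- move=> i; apply: (measurable_cantor M_lin M_ge0 b (P := fun s => decode s i)).
  apply: (cantor_decode (P := fun x => x i)).
  by apply: (@cube_lipschitz_coord _ _ id 1) => // s t _ _; rewrite mul1r.
- move=> P lP; apply: (integrable_cantor M_lin M_ge0 b mu_itv (P := fun s => P (decode s))).
  exact: cantor_decode.
- move=> P lP; rewrite (integral_cantor M_lin M_ge0 b mu_itv (P := fun s => P (decode s))).
    by congr (M _)%:E; apply/funext => x; rewrite decode_encode.
  exact: cantor_decode.
Qed.

End Coupling.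

(** * Push-forward of a density *)

Section DensityPushforward.
Local Open Scope classical_set_scope.
Local Open Scope ereal_scope.
Context d1 d2 (X : measurableType d1) (Y : measurableType d2) (R : realType).
Variables (mu : {measure set X -> \bar R}) (w : X -> R) (phi : X -> Y).
Hypothesis mphi : measurable_fun setT phi.
Hypothesis mw : measurable_fun setT w.
Hypothesis w0 : forall x, (0 <= w x)%R.

Definition density_pushforward (A : set Y) : \bar R := \int[mu]_(x in phi @^-1` A) (w x)%:E.

Let mpre A : measurable A -> measurable (phi @^-1` A).
Proof. by move=> mA; rewrite -[X in measurable X]setTI; exact: mphi. Qed.

Let mwE (A : set X) : measurable_fun A (fun x => (w x)%:E).
Proof. by apply/measurable_EFinP; exact: measurable_funTS. Qed.

Let density_pushforward0 : density_pushforward set0 = 0.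
Proof. by rewrite /density_pushforward preimage_set0 integral_set0. Qed.

Let density_pushforward_ge0 A : 0 <= density_pushforward A.
Proof. by apply: integral_ge0 => x _; rewrite lee_fin. Qed.

Let density_pushforward_sigma_additive : semi_sigma_additive density_pushforward.
Proof.
move=> F mF tF mUF; rewrite /density_pushforward; apply: cvg_toP.
  apply: ereal_nondecreasing_is_cvgn => m n mn.
  apply: lee_sum_nneg_natr => // k _ _.
  by apply: integral_ge0 => x _; rewrite lee_fin.
rewrite preimage_bigcup ge0_integral_bigcup //=.
- by move=> k; exact: mpre.
- by move=> x _; rewrite lee_fin.
- apply/trivIsetP => /= i j _ _ ij; rewrite -preimage_setI.
  by move/trivIsetP : tF => /(_ _ _ _ _ ij) ->//; rewrite preimage_set0.
Qed.

HB.instance Definition _ := isMeasure.Build _ _ _ density_pushforward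
  density_pushforward0 density_pushforward_ge0 density_pushforward_sigma_additive.

Import HBNNSimple.

Let integral_nnsfun_density (h : {nnsfun Y >-> R}) :
  \int[density_pushforward]_y (h y)%:E = \int[mu]_x ((w x)%:E * (h (phi x))%:E).
Proof.
rewrite integralT_nnsfun sintegralE.
pose F (k : R) x := (w x * (k * \1_(h @^-1` [set k]) (phi x)))%:E.
have mF k : measurable_fun setT (F k).
  apply/measurable_EFinP; apply: measurable_funM => //.
  apply: measurable_funM => //; apply: (measurableT_comp _ mphi).
  exact: measurable_indic.
transitivity (\int[mu]_x (\sum_(k \in range h) F k x)); last first.
  apply: eq_integral => x _; rewrite /F fsumEFin // -EFinM fimfunE; congr EFin.
  by rewrite mulr_fsumr.
rewrite ge0_integral_fsum //; last first.
  move=> k x _; rewrite lee_fin mulr_ge0 // -lee_fin EFinM.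
  exact: nnfun_muleindic_ge0.
apply: eq_fsbigr => k; rewrite inE => -[y _ hy].
have k0 : (0 <= k)%R by rewrite -hy; exact: fun_ge0.
rewrite /density_pushforward -ge0_integralZl //; last 2 first.
- exact: mpre.
- by move=> x _; rewrite lee_fin.
rewrite [LHS]integral_mkcond; apply: eq_integral => x _; rewrite /F patchE indicE.
have -> : (x \in phi @^-1` (h @^-1` [set k])) = (phi x \in h @^-1` [set k]).
  by apply/idP/idP; rewrite !inE.
by case: (_ \in _); rewrite ?mulr1 ?mulr0 // -EFinM mulrC.
Qed.

Lemma ge0_integral_density_pushforward (f : Y -> \bar R) :
  measurable_fun setT f -> (forall y, 0 <= f y) ->
  \int[density_pushforward]_y f y = \int[mu]_x ((w x)%:E * f (phi x)).
Proof.
move=> mf f0; pose f_ := nnsfun_approx measurableT mf.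
transitivity (limn (fun n => \int[density_pushforward]_y (f_ n y)%:E)).
  rewrite -monotone_convergence//.
  - apply: eq_integral => y _; apply/esym/cvg_lim => //.
    by apply: cvg_nnsfun_approx.
  - by move=> n; exact/measurable_EFinP/measurable_funP.
  - by move=> n y _; rewrite lee_fin.
  - by move=> y _ m n mn; rewrite lee_fin; exact/lefP/nd_nnsfun_approx.
under eq_fun do rewrite integral_nnsfun_density.
rewrite -monotone_convergence//.
- apply: eq_integral => x _; apply/cvg_lim => //.
  apply: cvgeZl => //; exact: cvg_nnsfun_approx.
- move=> n; apply: emeasurable_funM => //.
  apply/measurable_EFinP; apply: (measurableT_comp _ mphi).
  exact: measurable_funP.
- by move=> n x _; rewrite mule_ge0 // lee_fin.
- move=> x _ m n mn; rewrite lee_wpmul2l ?lee_fin //.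
  exact/lefP/nd_nnsfun_approx.
Qed.

(** Multiplication by [w >= 0] commutes with taking positive and negative parts, so the nonnegative
    case applies to each part, infinite values included. *)
Lemma integral_density_pushforward (f : Y -> R) : measurable_fun setT f ->
  \int[density_pushforward]_y (f y)%:E = \int[mu]_x (w x * f (phi x))%:E.
Proof.
move=> mf; have mEf : measurable_fun setT (EFin \o f) by exact/measurable_EFinP.
rewrite [LHS]integralE [RHS]integralE.
rewrite !ge0_integral_density_pushforward //.
- congr (_ - _); apply: eq_integral => x _.
    by rewrite !funeposE /= EFinM maxe_pMr ?lee_fin // mule0.
  by rewrite !funenegE EFinM -muleN maxe_pMr ?lee_fin // mule0.
- exact: measurable_funeneg.
- exact: measurable_funepos.
Qed.

Lemma exists_density_pushforward : exists kappa : {measure set Y -> \bar R},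
  forall f : Y -> R, measurable_fun setT f ->
    \int[kappa]_y (f y)%:E = \int[mu]_x (w x * f (phi x))%:E.
Proof. by exists density_pushforward => f; exact: integral_density_pushforward. Qed.

End DensityPushforward.

(** * The Levy measure of a conditionally positive functional *)

Section DominatedFunctional.
Local Open Scope classical_set_scope.
Context {R : realType} {n : nat}.
Implicit Types (f g : ('I_n -> R) -> R) (q : {mpoly R[n]}) (x : 'I_n -> R).

Definition normsq x : R := \sum_i x i ^+ 2.

(** Vanishing to second order at the origin makes its multiples admissible majorants, on which
    conditional positivity can act. *)
Definition growth_poly k : {mpoly R[n]} := (\sum_(i < n) 'X_i ^+ 2) * onep_normsq ^+ k.

Lemma normsq_ge0 x : 0 <= normsq x.
Proof. by apply: sumr_ge0 => i _; exact: sqr_ge0. Qed.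

Lemma growth_polyE k x : (growth_poly k).@[x] = normsq x * (1 + normsq x) ^+ k.
Proof.
rewrite mevalM meval_onep_normsqX onep_normsqE raddf_sum /=; congr (_ * _).
by apply: eq_bigr => i _; rewrite rmorphXn /= mevalXU.
Qed.

Lemma growth_poly_ge0 k x : 0 <= (growth_poly k).@[x].
Proof. by rewrite growth_polyE mulr_ge0 ?exprn_ge0 ?addr_ge0 ?normsq_ge0. Qed.

Lemma growth_poly_le j k x : (j <= k)%N -> (growth_poly j).@[x] <= (growth_poly k).@[x].
Proof.
move=> jk; rewrite !growth_polyE ler_wpM2l ?normsq_ge0 // ler_weXn2l //.
by rewrite lerDl normsq_ge0.
Qed.

Lemma growth_poly0 k : (growth_poly k).@[fun=> 0] = 0.
Proof.
rewrite growth_polyE /normsq big1 ?mul0r // => i _.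
by rewrite expr0n.
Qed.

Definition dominated f := exists k (C : R), forall x, `|f x| <= C * (growth_poly k).@[x].

Lemma dominated_lin (c : R) f g : dominated f -> dominated g ->
  dominated (fun x => c * f x + g x).
Proof.
move=> [k [C hC]] [l [D hD]]; exists (maxn k l), (`|c| * `|C| + `|D|) => x.
rewrite (le_trans (ler_normD _ _)) // normrM mulrDl lerD //.
  rewrite -mulrA ler_wpM2l // (le_trans (hC x)) //.
  rewrite (le_trans (ler_wpM2r (growth_poly_ge0 _ _) (ler_norm C))) // ler_wpM2l //.
  by rewrite growth_poly_le ?leq_maxl.
rewrite (le_trans (hD x)) //.
rewrite (le_trans (ler_wpM2r (growth_poly_ge0 _ _) (ler_norm D))) // ler_wpM2l //.
by rewrite growth_poly_le ?leq_maxr.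
Qed.

Lemma dominated_le f (g : ('I_n -> R) -> R) : dominated g -> (forall x, `|f x| <= `|g x|) ->
  dominated f.
Proof. by move=> [k [C h]] fg; exists k, C => x; exact: le_trans (fg x) (h x). Qed.

Lemma dominated_growth_poly k : dominated (fun x => (growth_poly k).@[x]).
Proof. by exists k, 1 => x; rewrite mul1r ger0_norm ?growth_poly_ge0. Qed.

Variable c : 'X_{1..n} -> R.
Hypothesis cp : conditionally_positive c.

Let upper f : set R := [set mom c q | q in [set q | q.@[fun=> 0] = 0 /\ forall x, f x <= q.@[x]]].

Let p f : R := inf (upper f).

Let mom_le q q' : q.@[fun=> 0] = 0 -> q'.@[fun=> 0] = 0 -> (forall x, q.@[x] <= q'.@[x]) ->
  mom c q <= mom c q'.
Proof.
move=> q0 q'0 h; rewrite -subr_ge0 -linearB; apply: cp.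
  by move=> x; rewrite mevalB subr_ge0.
by rewrite mevalB q0 q'0 subrr.
Qed.

Let has_inf_upper f : dominated f -> has_inf (upper f).
Proof.
move=> [k [C hC]]; have C0 : (C *: growth_poly k).@[fun=> 0] = 0.
  by rewrite mevalZ growth_poly0 mulr0.
split.
  exists (mom c (C *: growth_poly k)), (C *: growth_poly k) => //; split=> // x.
  by rewrite mevalZ (le_trans (ler_norm _)).
exists (mom c (- C *: growth_poly k)) => _ [q [q0 hq] <-].
apply: mom_le => // [|x]; first by rewrite mevalZ growth_poly0 mulr0.
rewrite mevalZ (le_trans _ (hq x)) // mulNr.
by have := hC x; rewrite ler_norml => /andP[].
Qed.

Let p_le f q : dominated f -> q.@[fun=> 0] = 0 -> (forall x, f x <= q.@[x]) -> p f <= mom c q.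
Proof. by move=> df q0 hq; apply: (ge_inf (has_inf_upper df).2); exists q. Qed.

Let p_ge f (t : R) : dominated f ->
  (forall q, q.@[fun=> 0] = 0 -> (forall x, f x <= q.@[x]) -> t <= mom c q) -> t <= p f.
Proof.
move=> df h; apply: lb_le_inf; first exact: (has_inf_upper df).1.
by move=> _ [q [q0 hq] <-]; exact: h.
Qed.

Let p_sublinear : sublinear_on dominated p.
Proof.
have dD f g : dominated f -> dominated g -> dominated (f + g).
  move=> df dg; have := dominated_lin 1 df dg; congr dominated.
  by apply/funext => x; rewrite mul1r.
have dZ (t : R) f : dominated f -> dominated (t *: f).
  move=> df; have [k [C hC]] := df; exists k, (`|t| * C) => x.
  by rewrite normrM -mulrA ler_wpM2l.
split=> [f g df dg|t f t0 df].
  rewrite -lerBlDr; apply: p_ge => // q q0 hq; rewrite lerBlDr -lerBlDl.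
  apply: p_ge => // q' q'0 hq'; rewrite lerBlDl -linearD; apply: p_le; first exact: dD.
    by rewrite mevalD q0 q'0 addr0.
  by move=> x; rewrite mevalD lerD.
apply/eqP; rewrite eq_le; apply/andP; split; last first.
  apply: p_ge => [|q q0 hq]; first exact: dZ.
  rewrite -ler_pdivlMl // -[leRHS]/(t^-1 *: mom c q) -linearZ; apply: p_le => // [|x].
    by rewrite mevalZ q0 mulr0.
  by rewrite mevalZ ler_pdivlMl //; exact: hq.
rewrite -ler_pdivrMl //; apply: p_ge => // q q0 hq; rewrite ler_pdivrMl //.
rewrite -[leRHS]/(t *: mom c q) -linearZ; apply: p_le; first exact: dZ.
  by rewrite mevalZ q0 mulr0.
by move=> x; rewrite mevalZ ler_pM2l.
Qed.

(** A linear minorant of [p] extends [mom c] automatically: a polynomial [q] majorises itself, and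
    so does [- q]. It is positive because the zero polynomial majorises [- f] when [f >= 0]. *)
Lemma dominated_functional : exists L : (('I_n -> R) -> R) -> R,
  [/\ forall (t : R) f g, dominated f -> dominated g ->
        L (fun x => t * f x + g x) = t * L f + L g,
      forall f, dominated f -> (forall x, 0 <= f x) -> 0 <= L f &
      forall q, q.@[fun=> 0] = 0 -> dominated (fun x => q.@[x]) ->
        L (fun x => q.@[x]) = mom c q].
Proof.
have [|L [LD LZ Lp]] := sublinear_linear_minorant _ p_sublinear.
  by move=> t f g; exact: dominated_lin.
have dN f : dominated f -> dominated (- f).
  by move=> df; apply: dominated_le df _ => x; rewrite normrN.
have LN f : dominated f -> L (- f) = - L f.
  by move=> df; rewrite -scaleN1r LZ // mulN1r.
have dZ (t : R) f : dominated f -> dominated (t *: f).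
  move=> df; have [k [C hC]] := df; exists k, (`|t| * C) => x.
  by rewrite normrM -mulrA ler_wpM2l.
exists L; split=> [t f g df dg|f df f0|q q0 dq].
- by rewrite -LZ // -LD //; exact: dZ.
- rewrite -oppr_le0 -LN // -(linear0 (mom c)).
  apply: le_trans (Lp _ (dN _ df)) (p_le (dN _ df) _ _); first by rewrite meval0.
  by move=> x; rewrite meval0 oppr_le0.
- apply/eqP; rewrite eq_le; apply/andP; split.
    exact: le_trans (Lp _ dq) (p_le dq q0 _).
  rewrite -lerN2 -LN // -linearN.
  apply: le_trans (Lp _ (dN _ dq)) (p_le (dN _ dq) _ _).
    by rewrite mevalN q0 oppr0.
  by move=> x; rewrite mevalN.
Qed.

End DominatedFunctional.

Section PolarCoordinates.
Context {R : realType} {n : nat}.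
Implicit Types (x : 'I_n -> R) (al : 'X_{1..n}) (K : R).

Definition radius x : R := Num.sqrt (normsq x).

Lemma radius_ge0 x : 0 <= radius x. Proof. exact: sqrtr_ge0. Qed.

Lemma sqr_radius x : radius x ^+ 2 = normsq x.
Proof. by rewrite sqr_sqrtr // normsq_ge0. Qed.

Lemma ler_norm_radius x i : `|x i| <= radius x.
Proof.
rewrite -sqrtr_sqr ler_wsqrtr // /normsq (bigD1 i) //= lerDl.
by apply: sumr_ge0 => j _; exact: sqr_ge0.
Qed.

(** Division by zero gives direction [0] at the origin; [direction_monomial] holds there too, all
    coordinates being [0]. *)
Definition direction x i : R := x i / radius x.

Lemma direction_bound x i : `|direction x i| <= 1.
Proof.
rewrite /direction normrM normfV (ger0_norm (radius_ge0 x)).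
have := radius_ge0 x; rewrite le_eqVlt => /predU1P[<-|r0].
  by rewrite invr0 mulr0.
by rewrite ler_pdivrMr // mul1r ler_norm_radius.
Qed.

Lemma direction_monomial x al :
  \prod_i x i ^+ al i = radius x ^+ mdeg al * \prod_i direction x i ^+ al i.
Proof.
have E i : x i = radius x * direction x i.
  have [r0|r0] := eqVneq (radius x) 0.
    have := ler_norm_radius x i; rewrite r0 normr_le0 => /eqP ->.
    by rewrite mul0r.
  by rewrite /direction mulrC divfK.
under eq_bigr do rewrite [X in X ^+ _]E exprMn.
by rewrite big_split /= prodrXr -mdegE.
Qed.

Lemma direction_monomial_bound x al : `|\prod_i direction x i ^+ al i| <= 1.
Proof.
rewrite normr_prod; apply: prodr_ile1 => i _.
by rewrite normr_ge0 normrX exprn_ile1 // direction_bound.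
Qed.

Lemma radius_growth k x : radius x ^+ k.+2 <= (growth_poly k).@[x].
Proof.
rewrite growth_polyE -addn2 exprD mulrC sqr_radius ler_wpM2l ?normsq_ge0 //.
apply: lerXn2r; rewrite ?nnegrE ?radius_ge0 ?addr_ge0 ?normsq_ge0 //.
rewrite -sqr_radius; have := radius_ge0 x; move: (radius x) => r r0.
by have := sqr_ge0 (r - 2^-1); rewrite sqrrB; lra.
Qed.

(* [clip K (1 / (1 + r)) = min r K], written so as to be Lipschitz in its argument. *)
Definition clip K (t : R) : R := (Num.max t (1 + K)^-1)^-1 - 1.

Lemma clipE K r : 0 <= K -> 0 <= r -> clip K (1 + r)^-1 = Num.min r K.
Proof.
move=> K0 r0; have e s : 1 + s - 1 = s :> R by rewrite addrAC subrr add0r.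
have K1 : 0 < 1 + K by rewrite ltr_pwDl.
have r1 : 0 < 1 + r by rewrite ltr_pwDl.
rewrite /clip; have [rK|Kr] := leP r K.
  by rewrite max_l ?invrK // lef_pV2 ?posrE // lerD2l.
by rewrite max_r ?invrK // lef_pV2 ?posrE // lerD2l ltW.
Qed.

Lemma clip0 K : 0 <= K -> clip K 0 = K.
Proof.
move=> K0; rewrite /clip max_r ?invrK; first by rewrite addrAC subrr add0r.
by rewrite invr_ge0 addr_ge0.
Qed.

Lemma clip_lipschitz K s t : 0 <= K -> `|clip K s - clip K t| <= (1 + K) ^+ 2 * `|s - t|.
Proof.
move=> K0; rewrite /clip; set b := (1 + K)^-1.
have b0 : 0 < b by rewrite invr_gt0; lra.
have -> : 1 + K = b^-1 by rewrite invrK.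
set u := Num.max s b; set v := Num.max t b.
have ub : b <= u by rewrite le_max lexx orbT.
have vb : b <= v by rewrite le_max lexx orbT.
have u0 : 0 < u by exact: lt_le_trans ub.
have v0 : 0 < v by exact: lt_le_trans vb.
have uv : `|u - v| <= `|s - t|.
  rewrite /u /v; case: (leP s b) => sb; case: (leP t b) => tb.
  - by rewrite subrr normr0.
  - rewrite ler_norml; have := ler_norm (s - t); have := ler_norm (t - s).
    by rewrite distrC => h1 h2; apply/andP; split; lra.
  - rewrite ler_norml; have := ler_norm (s - t); have := ler_norm (t - s).
    by rewrite distrC => h1 h2; apply/andP; split; lra.
  - by [].
have -> : u^-1 - 1 - (v^-1 - 1) = (v - u) * (u^-1 * v^-1).
  by field; rewrite (gt_eqF u0) (gt_eqF v0).
rewrite normrM distrC mulrC; apply: ler_pM => //.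
rewrite ger0_norm ?mulr_ge0 ?invr_ge0 ?(ltW u0) ?(ltW v0) // expr2.
by apply: ler_pM; rewrite ?invr_ge0 ?(ltW u0) ?(ltW v0) // lef_pV2.
Qed.

(** The last coordinate is [1] at the origin and tends to [0] at infinity; directions are rescaled
    from [[-1, 1]] to the unit interval. *)
Definition polar x (o : option 'I_n) : R :=
  if o is Some i then (direction x i + 1) / 2 else (1 + radius x)^-1.

Lemma polar_cube x : in_cube (polar x).
Proof.
move=> [i|] /=.
  have := direction_bound x i; rewrite ler_norml => /andP[h1 h2].
  by apply/andP; split; lra.
have := radius_ge0 x => r0; rewrite invr_ge0 addr_ge0 //= invf_le1; lra.
Qed.

(** For degree at least two, [x^al / |x|^2] is [r^(|al| - 2)] times a monomial in the direction;
    replacing [r] by [min r K] makes it Lipschitz on the cube. *)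
Definition clip_monomial K al (z : option 'I_n -> R) : R :=
  clip K (z None) ^+ (mdeg al - 2) * \prod_i (2 * z (Some i) - 1) ^+ al i.

Lemma clip_monomial_lipschitz K al : 0 <= K -> cube_lipschitz (clip_monomial K al).
Proof.
move=> K0; apply: cube_lipschitzM.
  apply: cube_lipschitzX; apply: (@cube_lipschitz_coord _ _ (clip K) ((1 + K) ^+ 2)).
    by rewrite exprn_ge0 // addr_ge0.
  by move=> s t _ _; exact: clip_lipschitz.
apply: cube_lipschitz_prod => i; apply: cube_lipschitzX.
apply: (@cube_lipschitz_coord _ _ (fun s => 2 * s - 1) 2) => // s t _ _.
have -> : 2 * s - 1 - (2 * t - 1) = 2 * (s - t) by ring.
by rewrite normrM ger0_norm.
Qed.

Lemma clip_monomial_polar K al x : 0 <= K -> clip_monomial K al (polar x) =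
  Num.min (radius x) K ^+ (mdeg al - 2) * \prod_i direction x i ^+ al i.
Proof.
move=> K0; rewrite /clip_monomial /= clipE ?radius_ge0 //; congr (_ * _).
by apply: eq_bigr => i _; congr (_ ^+ _); field.
Qed.

(** The two sides differ only where [r > K]; a factor [r / K] inserted there gains [1/K] and costs
    one power of the radius. *)
Lemma clip_approx K al x : 0 < K -> (2 <= mdeg al)%N ->
  `|\prod_i x i ^+ al i - clip_monomial K al (polar x) * normsq x| <=
  K^-1 * (growth_poly (mdeg al).-1).@[x].
Proof.
move=> K0 al2; rewrite (clip_monomial_polar _ _ (ltW K0)) direction_monomial.
rewrite -sqr_radius -(subnK al2); set k := (mdeg al - 2)%N.
rewrite addn2 subSS subSS subn0 /=.
set r := radius x; set T := \prod_i _.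
have r0 : 0 <= r by exact: radius_ge0.
have -> : r ^+ k.+2 * T - Num.min r K ^+ k * T * r ^+ 2 =
    (r ^+ k - Num.min r K ^+ k) * r ^+ 2 * T by rewrite -addn2 exprD; ring.
rewrite normrM -[leRHS]mulr1; apply: ler_pM => //; last first.
  exact: direction_monomial_bound.
have G : r ^+ k.+1.+2 <= (growth_poly k.+1).@[x] by exact: radius_growth.
have [rK|Kr] := leP r K.
  rewrite subrr mul0r normr0 mulr_ge0 ?invr_ge0 ?(ltW K0) //.
  exact: growth_poly_ge0.
rewrite ger0_norm; last first.
  by rewrite mulr_ge0 ?sqr_ge0 // subr_ge0 lerXn2r ?nnegrE // ltW.
rewrite ler_pdivlMl // (le_trans _ G) // -[k.+1.+2]addn2 exprD mulrA.
apply: ler_wpM2r; first exact: sqr_ge0.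
rewrite exprS; apply: ler_pM; rewrite ?(ltW K0) ?(ltW Kr) ?subr_ge0 //.
  by rewrite lerXn2r ?nnegrE // ltW.
by rewrite lerBlDr lerDl exprn_ge0 // ltW.
Qed.

End PolarCoordinates.

Section RadialFunctional.
Local Open Scope classical_set_scope.
Context {R : realType} {n : nat}.
Implicit Types (x : 'I_n -> R) (al : 'X_{1..n}) (K : R) (f g : ('I_n -> R) -> R).
Variable c : 'X_{1..n} -> R.
Hypothesis cp : conditionally_positive c.

(** [M f] is the extended functional at [f |x|^2]. The third clause recovers [c] as [K] grows; the
    fourth, uniform in [K], will exclude mass at infinity and supply integrable majorants. *)
Lemma radial_functional : exists M : (('I_n -> R) -> R) -> R,
  [/\ forall (t : R) f g, bounded_map f -> bounded_map g ->
        M (fun x => t * f x + g x) = t * M f + M g,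
      forall f, bounded_map f -> (forall x, 0 <= f x) -> 0 <= M f,
      forall K al, 0 < K -> (2 <= mdeg al)%N ->
        `|c al - M (fun x => clip_monomial K al (polar x))|
           <= K^-1 * mom c (growth_poly (mdeg al).-1) &
      forall K k, 0 < K -> M (fun x => clip K (polar x None) ^+ k) <= mom c (growth_poly k)].
Proof.
have [L [Llin Lpos Lpoly]] := dominated_functional cp.
have dom f : bounded_map f -> dominated (fun x => f x * normsq x).
  move=> [C hC]; exists 0, C => x; rewrite growth_polyE expr0 mulr1 normrM.
  by rewrite [`|normsq x|]ger0_norm ?normsq_ge0 // ler_wpM2r ?normsq_ge0.
have L_le f g : dominated f -> dominated g -> (forall x, f x <= g x) -> L f <= L g.
  move=> df dg fg; have := Lpos _ (dominated_lin (-1) df dg).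
  rewrite Llin // mulN1r addrC subr_ge0; apply => x.
  by rewrite mulN1r addrC subr_ge0.
have L_dist (e : R) f g h : dominated f -> dominated g -> dominated h ->
    (forall x, `|f x - g x| <= e * h x) -> `|L f - L g| <= e * L h.
  move=> df dg dh fg.
  have fg' x : - (e * h x) <= f x - g x <= e * h x by rewrite -ler_norml.
  have h1 : L f <= L (fun x => e * h x + g x).
    apply: L_le => // [|x]; first exact: dominated_lin.
    by have := fg' x; lra.
  have h2 : L (fun x => - e * h x + g x) <= L f.
    apply: L_le => // [|x]; first exact: dominated_lin.
    by have := fg' x; lra.
  by move: h1 h2; rewrite !Llin // mulNr ler_norml; lra.
have clip_bounded K k : 0 < K -> bounded_map (fun x => clip K (polar x None) ^+ k).
  move=> K0; exists (K ^+ k) => x; rewrite /= (clipE (ltW K0) (radius_ge0 x)) normrX.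
  have m0 : 0 <= Num.min (radius x) K by rewrite le_min radius_ge0 ltW.
  rewrite (ger0_norm m0); apply: lerXn2r; rewrite ?nnegrE //; first exact: ltW.
  by rewrite ge_min lexx orbT.
exists (fun f => L (fun x => f x * normsq x)); split.
- move=> t f g bf bg; rewrite -Llin; try exact: dom.
  by congr L; apply/funext => x; ring.
- move=> f bf f0; apply: Lpos; first exact: dom.
  by move=> x; rewrite mulr_ge0 ?normsq_ge0.
- move=> K al K0 al2.
  have bH : bounded_map (fun x => clip_monomial K al (polar x)).
    have [C [_ hC]] := cube_lipschitz_bounded (clip_monomial_lipschitz al (ltW K0)).
    by exists C => x; apply: hC; exact: polar_cube.
  have dmon : dominated (fun x => ('X_[al] : {mpoly R[n]}).@[x]).
    exists (mdeg al - 2)%N, 1 => x; rewrite mul1r mevalX direction_monomial.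
    rewrite normrM normrX (ger0_norm (radius_ge0 x)).
    rewrite (le_trans _ (radius_growth _ x)) // -[leRHS]mulr1.
    rewrite -addn2 subnK // ler_wpM2l ?exprn_ge0 ?radius_ge0 //.
    exact: direction_monomial_bound.
  have mon0 : ('X_[al] : {mpoly R[n]}).@[fun=> 0] = 0.
    rewrite meval0E mcoeffX; case: eqP => // al0.
    by move: al2; rewrite al0 mdeg0.
  have -> : c al = L (fun x => ('X_[al] : {mpoly R[n]}).@[x]) by rewrite Lpoly // momX.
  set k := (mdeg al).-1.
  have <- : L (fun x => (growth_poly k).@[x]) = mom c (growth_poly k).
    by apply: Lpoly; [exact: growth_poly0|exact: dominated_growth_poly].
  have dP := @dominated_growth_poly R n k.
  apply: L_dist => //; first exact: dom.
  by move=> x; rewrite mevalX; exact: clip_approx.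
- move=> K k K0.
  have <- : L (fun x => (growth_poly k).@[x]) = mom c (growth_poly k).
    by apply: Lpoly; [exact: growth_poly0|exact: dominated_growth_poly].
  apply: L_le => [||x]; [exact: dom (clip_bounded K k K0)|exact: dominated_growth_poly|].
  rewrite /= (clipE (ltW K0) (radius_ge0 x)) growth_polyE mulrC ler_wpM2l ?normsq_ge0 //.
  apply: (@le_trans _ _ (radius x ^+ k)).
    apply: lerXn2r; rewrite ?nnegrE ?radius_ge0 //; last by rewrite ge_min lexx.
    by rewrite le_min radius_ge0 ltW.
  apply: lerXn2r; rewrite ?nnegrE ?radius_ge0 ?addr_ge0 ?normsq_ge0 //.
  rewrite -sqr_radius; have := radius_ge0 x; move: (radius x) => r r0.
  by have := sqr_ge0 (r - 2^-1); rewrite sqrrB; lra.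
Qed.

End RadialFunctional.

Section MeasurableInverse.
Local Open Scope classical_set_scope.

Lemma measurable_funV_ge0 d (X : measurableType d) (R : realType)
    (D : set X) (f : X -> R) : measurable_fun D f -> (forall x, 0 <= f x) ->
  measurable_fun D (fun x => (f x)^-1).
Proof.
move=> mf f0; rewrite (_ : (fun x => _) = (fun x => f x `^ (-1))).
  by apply: (measurableT_comp (measurable_powR (-1))).
by apply/funext => x; rewrite powR_inv1.
Qed.

End MeasurableInverse.

(** * From the coupling to the matrix and the measure *)

Section LevyRepresentation.
Local Open Scope classical_set_scope.
Context {R : realType} {n : nat}.
Implicit Types (al : 'X_{1..n}) (K : R) (k : nat).
Variable c : 'X_{1..n} -> R.
Variables (mu : {measure set R -> \bar R}) (D : set R) (G : R -> option 'I_n -> R).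
Hypothesis mD : measurable D.
Hypothesis G_cube : forall u, in_cube (G u).
Hypothesis mG : forall o, measurable_fun D (fun u => G u o).
Variables (B : 'X_{1..n} -> R) (C : nat -> R).
Hypothesis G_int : forall K al, 0 < K ->
  mu.-integrable D (fun u => (clip_monomial K al (G u))%:E).
Hypothesis G_lim : forall K al, 0 < K -> (2 <= mdeg al)%N -> exists I : R,
  (\int[mu]_(u in D) (clip_monomial K al (G u))%:E)%E = I%:E /\ `|c al - I| <= K^-1 * B al.
Hypothesis G_clip : forall K k, 0 < K ->
  (\int[mu]_(u in D) (clip K (G u None) ^+ k)%:E <= (C k)%:E)%E.

Let rho : R -> R := (fun u => G u None) \_ D.
(** Inverts [r |-> 1 / (1 + r)]. Since [0^-1 = 0], the maximum gives radius [0] both at infinite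
    radius and outside [D]. *)
Let rt (u : R) : R := Num.max 0 ((rho u)^-1 - 1).
Let th (i : 'I_n) : R -> R := (fun u => 2 * G u (Some i) - 1) \_ D.

Let rho_in u : D u -> rho u = G u None.
Proof. by move=> Du; rewrite /rho patchE mem_set. Qed.

Let rho_out u : ~ D u -> rho u = 0.
Proof. by move=> Du; rewrite /rho patchE memNset. Qed.

Let th_in i u : D u -> th i u = 2 * G u (Some i) - 1.
Proof. by move=> Du; rewrite /th patchE mem_set. Qed.

Let th_out i u : ~ D u -> th i u = 0.
Proof. by move=> Du; rewrite /th patchE memNset. Qed.

Let rt_ge0 u : 0 <= rt u. Proof. by rewrite /rt le_max lexx. Qed.

Let rt_pos u : D u -> 0 < G u None -> G u None = (1 + rt u)^-1.
Proof.
move=> Du g0; have /andP[_ g1] := G_cube u None.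
rewrite /rt rho_in // max_r; first by rewrite addrC subrK invrK.
by rewrite subr_ge0 -[leLHS]invr1 lef_pV2 ?posrE.
Qed.

Let rt_rho0 u : rho u = 0 -> rt u = 0.
Proof. by move=> r0; rewrite /rt r0 invr0 max_l // sub0r oppr_le0. Qed.

Let rt_out u : ~ D u -> rt u = 0. Proof. by move=> /rho_out; exact: rt_rho0. Qed.

Let th_bound i u : `|th i u| <= 1.
Proof.
have [Du|Du] := pselect (D u); last by rewrite th_out // normr0.
have /andP[g0 g1] := G_cube u (Some i).
by rewrite th_in // ler_norml; apply/andP; split; lra.
Qed.

Let thm al u : R := \prod_i th i u ^+ al i.

Let thm_bound al u : `|thm al u| <= 1.
Proof.
rewrite normr_prod; apply: prodr_ile1 => i _.
by rewrite normr_ge0 normrX exprn_ile1.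
Qed.

Let clip_eq K u : D u -> 0 <= K -> 0 < G u None -> clip K (G u None) = Num.min (rt u) K.
Proof. by move=> Du K0 g0; rewrite (rt_pos Du g0) clipE. Qed.

Let G0_cases u : G u None = 0 \/ 0 < G u None.
Proof.
have /andP[g0 _] := G_cube u None.
by move: g0; rewrite le_eqVlt => /predU1P[<-|]; [left|right].
Qed.

Let clip_ge K u : D u -> 0 <= K -> Num.min (rt u) K <= clip K (G u None).
Proof.
move=> Du K0; have [g0|g0] := G0_cases u; last by rewrite clip_eq.
by rewrite g0 clip0 // ge_min lexx orbT.
Qed.

Let mrho : measurable_fun setT rho.
Proof. by apply/(measurable_restrictT _ mD); exact: mG. Qed.

Let rho_ge0 u : 0 <= rho u.
Proof.
have [Du|Du] := pselect (D u); last by rewrite rho_out.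
by rewrite rho_in //; case/andP: (G_cube u None).
Qed.

Let mrt : measurable_fun setT rt.
Proof.
apply: measurable_maxr => //; apply: measurable_funB => //.
exact: measurable_funV_ge0.
Qed.

Let mth i : measurable_fun setT (th i).
Proof.
apply/(measurable_restrictT _ mD); apply: measurable_funB => //.
by apply: measurable_funM => //; exact: mG.
Qed.

Let mthm al : measurable_fun setT (thm al).
Proof. by apply: measurable_prod => i _; exact: measurable_funX. Qed.

Let mclip K k : 0 < K -> measurable_fun D (fun u => (clip K (G u None) ^+ k)%:E).
Proof.
move=> K0; apply/measurable_EFinP; apply: measurable_funX.
apply: measurable_funB => //; apply: measurable_funV_ge0; first exact: measurable_maxr.
by move=> u; rewrite le_max invr_ge0 addr_ge0 ?ler01 ?(ltW K0) ?orbT.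
Qed.

(** Monotone convergence along integer truncations, each bounded by the clipped radius even where
    [rho] is [0]. *)
Let integral_rtX k : (\int[mu]_(u in D) (rt u ^+ k)%:E <= (C k)%:E)%E.
Proof.
pose f N u := (Num.min (rt u) N.+1%:R ^+ k)%:E.
have f0 N u : (0 <= f N u)%E by rewrite lee_fin exprn_ge0 // le_min rt_ge0 ler0n.
have mf N : measurable_fun D (f N).
  apply/measurable_EFinP; apply: measurable_funTS; apply: measurable_funX.
  exact: measurable_minr.
have ndf u : nondecreasing_seq (f^~ u).
  move=> i j ij; rewrite lee_fin lerXn2r ?nnegrE ?le_min ?rt_ge0 ?ler0n //.
  by rewrite !ge_min lexx /= ler_nat ltnS ij orbT.
have := @cvg_monotone_convergence _ _ R mu D mD f mf (fun N u _ => f0 N u) (fun u _ => ndf u).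
have -> : (\int[mu]_(u in D) limn (f^~ u))%E = (\int[mu]_(u in D) (rt u ^+ k)%:E)%E.
  apply: eq_integral => u _; apply/cvg_lim => //; apply: cvg_near_cst.
  have := archi_boundP (rt_ge0 u); set N := Num.bound _ => hN.
  exists N => // j /= Nj; rewrite /f min_l // (le_trans (ltW hN)) // ler_nat.
  exact: leqW.
move=> cv; apply: (cvge_to_le cv); apply: nearW => N.
apply: le_trans (G_clip k (ltr0Sn R N)); apply: ge0_le_integral => //.
- exact: mclip.
- move=> u Du; rewrite lee_fin lerXn2r ?nnegrE ?le_min ?rt_ge0 ?ler0n ?clip_ge //.
  by rewrite (le_trans _ (clip_ge Du _)) // le_min rt_ge0 ler0n.
Qed.

Let integrable_rtX k : mu.-integrable D (fun u => (rt u ^+ k)%:E).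
Proof.
apply/integrableP; split.
  by apply/measurable_EFinP; apply: measurable_funTS; exact: measurable_funX.
apply: le_lt_trans (ltry (C k)); apply: le_trans (integral_rtX k).
rewrite le_eqVlt; apply/orP; left; apply/eqP; apply: eq_integral => u _.
by rewrite gee0_abs // lee_fin exprn_ge0.
Qed.

Let Z : set R := D `&` [set u | rho u = 0].

Let mZ : measurable Z.
Proof.
apply: measurableI => //; rewrite -[X in measurable X]setTI.
exact: (mrho _ (measurable_set1 0)).
Qed.

(** Markov's inequality at infinity: on [Z] the clipped radius equals the truncation level, so every
    level times [mu Z] is at most [C 1]. *)
Let Z_null : mu Z = 0%E.
Proof.
have h N : (N.+1%:R%:E * mu Z <= (C 1)%:E)%E.
  apply: le_trans (G_clip 1 (ltr0Sn R N)).
  have cl0 u : D u -> 0 <= clip N.+1%:R (G u None).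
    by move=> Du; rewrite (le_trans _ (clip_ge Du _)) // le_min rt_ge0 ler0n.
  have mcl := mclip 1 (ltr0Sn R N).
  rewrite -integral_cst //.
  apply: (@le_trans _ _ (\int[mu]_(u in Z) (clip N.+1%:R (G u None) ^+ 1)%:E)%E).
    apply: ge0_le_integral => //.
    - by move=> u _; rewrite lee_fin.
    - by apply: measurable_funS mcl => // u [].
    - by move=> u [Du]; rewrite /= rho_in // => ->; rewrite clip0.
  by apply: ge0_subset_integral => // u [].
have := h 0%N; rewrite mul1e => h0.
have mf : mu Z \is a fin_num.
  by rewrite ge0_fin_numE ?measure_ge0 // (le_lt_trans h0) // ltry.
move: h; rewrite -(fineK mf) => h; congr EFin; apply/eqP.
rewrite eq_le fine_ge0 ?measure_ge0 // andbT leNgt; apply/negP => r0.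
have := archi_boundP (normr_ge0 (C 1 / fine (mu Z))).
set N := Num.bound _; rewrite ltNge => /negP; apply.
have := h N; rewrite -EFinM lee_fin -ler_pdivlMr // => hN.
rewrite (le_trans _ (ler_norm _)) // (le_trans _ hN) // ler_nat.
exact: leqnSn.
Qed.

Let thmE al u : D u -> thm al u = \prod_i (2 * G u (Some i) - 1) ^+ al i.
Proof. by move=> Du; apply: eq_bigr => i _; rewrite th_in. Qed.

Let integrable_moment al : (2 <= mdeg al)%N ->
  mu.-integrable D (fun u => (rt u ^+ (mdeg al - 2) * thm al u)%:E).
Proof.
move=> al2; apply: le_integrable (integrable_rtX (mdeg al - 2)) => //.
  apply/measurable_EFinP; apply: measurable_funTS; apply: measurable_funM => //.
  exact: measurable_funX.
move=> u _; rewrite lee_fin normrM [leRHS]ger0_norm ?exprn_ge0 //.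
by rewrite ger0_norm ?exprn_ge0 // ler_piMr ?exprn_ge0.
Qed.

(** Off the null set [Z] the truncation is eventually inactive, and a power of the radius dominates;
    the error [B al / K] identifies the limit. *)
Let moment al : (2 <= mdeg al)%N ->
  (\int[mu]_(u in D) (rt u ^+ (mdeg al - 2) * thm al u)%:E = (c al)%:E)%E.
Proof.
move=> al2; have i1 := integrable_moment al2.
pose f N u := (clip_monomial N.+1%:R al (G u))%:E.
have N0 N : 0 < N.+1%:R :> R by [].
have mf N : measurable_fun D (f N) by exact: measurable_int (G_int al (N0 N)).
have cD : {ae mu, forall u, D u -> f^~ u @ \oo --> (rt u ^+ (mdeg al - 2) * thm al u)%:E}.
  exists Z; split=> // u /= /not_implyP [Du ncv]; split=> //=; rewrite rho_in //.
  have [//|g0] := G0_cases u; exfalso; apply: ncv.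
  apply: cvg_near_cst; have := archi_boundP (rt_ge0 u); set N := Num.bound _ => hN.
  exists N => // j /= Nj; rewrite /f /clip_monomial thmE // clip_eq // min_l //.
  by rewrite (le_trans (ltW hN)) // ler_nat leqW.
have dD : {ae mu, forall u N, D u -> (`|f N u| <= (rt u ^+ (mdeg al - 2))%:E)%E}.
  exists Z; split=> // u /= /existsNP [N] /not_implyP [Du h]; split=> //=.
  rewrite rho_in //; have [//|g0] := G0_cases u; exfalso; apply: h.
  rewrite lee_fin /clip_monomial -thmE // clip_eq // normrM -[leRHS]mulr1.
  apply: ler_pM => //; rewrite normrX ger0_norm; last by rewrite le_min rt_ge0 ler0n.
  by rewrite lerXn2r ?nnegrE ?le_min ?rt_ge0 ?ler0n // ge_min lexx.
have [_ _] := @dominated_convergence _ _ R mu D mD f _ _ mf (measurable_int mu i1) cD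
  (integrable_rtX (mdeg al - 2)) dD.
move=> /(cvg_unique (@ereal_hausdorff R)); apply.
have /choice [I hI] N := G_lim (N0 N) al2.
rewrite (_ : [sequence _]_n = EFin \o I); last by apply/funext => N /=; exact: (hI N).1.
apply: cvg_EFin; first exact: nearW.
apply/cvgrPdist_le => e e0.
have := archi_boundP (normr_ge0 (B al / e)); set N := Num.bound _ => hN.
exists N => // j /= Nj; apply: le_trans (hI j).2 _.
rewrite mulrC ler_pdivrMr // mulrC -ler_pdivrMr //.
rewrite (le_trans (ler_norm _)) // (le_trans (ltW hN)) // ler_nat.
exact: leqW.
Qed.

(** The density [|x|^-2]. Its default value [0] at radius [0] removes from [nu] both the part
    destined for [Sigma] and everything outside [D]. *)
Let w (u : R) : R := (rt u ^+ 2)^-1.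

Let phi (u : R) : n.-tuple R := [tuple rt u * th i u | i < n].

Let w_ge0 u : 0 <= w u. Proof. by rewrite invr_ge0 exprn_ge0. Qed.

Let mw : measurable_fun setT w.
Proof. by apply: measurable_funV_ge0 => [|u]; [exact: measurable_funX|exact: exprn_ge0]. Qed.

Let mphi : measurable_fun setT phi.
Proof.
apply/measurable_fun_tnthP => i; rewrite (_ : _ \o _ = fun u => rt u * th i u).
  exact: measurable_funM.
by apply/funext => u /=; rewrite tnth_mktuple.
Qed.

Let xpow_phi al u : xpow al (phi u) = rt u ^+ mdeg al * thm al u.
Proof.
rewrite /xpow; under eq_bigr do rewrite tnth_mktuple exprMn.
by rewrite big_split /= prodrXr -mdegE.
Qed.

Let w_xpow al u : (2 <= mdeg al)%N ->
  w u * xpow al (phi u) = (rt u != 0)%:R * (rt u ^+ (mdeg al - 2) * thm al u).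
Proof.
move=> al2; rewrite xpow_phi /w; have [->|r0] := eqVneq (rt u) 0.
  by rewrite expr0n invr0 !mul0r.
rewrite -{1}(subnK al2) exprD mul1r; field; exact: r0.
Qed.

Lemma levy_representation_of_coupling : exists (Sigma : 'M[R]_n)
    (nu : {measure set (n.-tuple R) -> \bar R}), psd_sym Sigma /\
  [/\ forall al, (2 <= mdeg al)%N ->
        (\int[nu]_(x in [set: n.-tuple R]) `|xpow al x|%:E < +oo)%E,
      forall i j, (c (U_(i) + U_(j))%MM)%:E
         = ((Sigma i j)%:E + \int[nu]_(x in [set: n.-tuple R]) (xpow (U_(i) + U_(j))%MM x)%:E)%E &
      forall al, (3 <= mdeg al)%N ->
        (c al)%:E = \int[nu]_(x in [set: n.-tuple R]) (xpow al x)%:E]%E.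
Proof.
have [nu nuT] := exists_density_pushforward mu mphi mw w_ge0.
have nuE (f : n.-tuple R -> R) : measurable_fun setT f ->
    (\int[nu]_x (f x)%:E = \int[mu]_(u in D) (w u * f (phi u))%:E)%E.
  move=> mf; rewrite nuT //.
  rewrite [RHS]integral_mkcond; apply: eq_integral => u _; rewrite patchE.
  case: ifPn => // uD; rewrite /w rt_out ?expr0n ?invr0 ?mul0r //.
  by move=> Du; move: uD; rewrite mem_set.
(* [Sigma] collects the second moments of the directions at radius [0]; as such it is positive
   semidefinite. *)
pose T i j u : R := (rt u == 0)%:R * (th i u * th j u).
have mT i j : measurable_fun setT (T i j).
  apply: measurable_funM; last exact: measurable_funM.
  have -> : (fun u => (rt u == 0)%:R : R) = \1_[set u | rt u = 0].
    apply/funext => u; rewrite indicE; congr (nat_of_bool _)%:R.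
    by apply/eqP/idP; rewrite inE.
  apply: measurable_indic; rewrite -[X in measurable X]setTI.
  exact: (mrt _ (measurable_set1 0)).
have T_int i j : mu.-integrable D (fun u => (T i j u)%:E).
  apply: le_integrable (integrable_rtX 0) => //.
    by apply/measurable_EFinP; apply: measurable_funTS.
  move=> u _; rewrite lee_fin expr0 normr1 /T !normrM.
  by case: eqP => _; rewrite ?normr0 ?mul0r // normr1 mul1r mulr_ile1.
pose s i j := fine (\int[mu]_(u in D) (T i j u)%:E)%E.
have sE i j : (\int[mu]_(u in D) (T i j u)%:E = (s i j)%:E)%E.
  by rewrite fineK //; exact: integrable_fin_num.
exists (\matrix_(i, j) s i j), nu; split; [|split].
- split.
    apply/matrixP => i j; rewrite !mxE /s; congr fine.
    by apply: eq_integral => u _; rewrite /T [th j u * _]mulrC.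
  move=> v; rewrite -lee_fin.
  have -> : (v^T *m (\matrix_(i, j) s i j) *m v) 0 0 =
      \sum_(ij : 'I_n * 'I_n) (v ij.1 0 * v ij.2 0) * s ij.1 ij.2.
    rewrite -(pair_big xpredT xpredT (fun i j => v i 0 * v j 0 * s i j)) /=.
    rewrite -mulmxA mxE; apply: eq_bigr => i _.
    rewrite !mxE mulr_sumr; apply: eq_bigr => j _.
    by rewrite !mxE; ring.
  have -> : ((\sum_(ij : 'I_n * 'I_n) (v ij.1 0 * v ij.2 0) * s ij.1 ij.2)%:E =
      \int[mu]_(u in D) ((rt u == 0)%:R * (\sum_i v i 0 * th i u) ^+ 2)%:E)%E.
    transitivity (\int[mu]_(u in D) (\sum_(ij : 'I_n * 'I_n)
        ((v ij.1 0 * v ij.2 0)%:E * (T ij.1 ij.2 u)%:E)%E)%E)%E.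
      rewrite integral_sum //; last by move=> ij; apply: integrableZl.
      rewrite -sumEFin; apply: eq_bigr => ij _.
      by rewrite integralZl // sE EFinM.
    apply: eq_integral => u _; rewrite sumEFin; congr EFin.
    rewrite -(pair_big xpredT xpredT
      (fun i j => v i 0 * v j 0 * T i j u)) /= expr2 mulr_suml mulr_sumr.
    apply: eq_bigr => i _; rewrite mulr_sumr mulr_sumr; apply: eq_bigr => j _.
    by rewrite /T; ring.
  apply: integral_ge0 => u _; rewrite lee_fin mulr_ge0 ?sqr_ge0 //.
- move=> al al2; rewrite nuE; last first.
    by apply: measurableT_comp => //; exact: measurable_xpow.
  apply: le_lt_trans (ltry (C (mdeg al - 2))).
  apply: le_trans (integral_rtX _); apply: ge0_le_integral => //.
  + by move=> u _; rewrite lee_fin mulr_ge0.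
  + apply/measurable_EFinP; apply: measurable_funTS; apply: measurable_funM => //.
    apply: measurableT_comp => //; apply: measurableT_comp => //.
    exact: measurable_xpow.
  + by apply/measurable_EFinP; apply: measurable_funTS; exact: measurable_funX.
  + move=> u _; rewrite lee_fin -[w u]ger0_norm // -normrM w_xpow // !normrM.
    rewrite [`|rt u ^+ _|]ger0_norm ?exprn_ge0 // -[leRHS]mul1r.
    apply: ler_pM; rewrite ?mulr_ge0 ?exprn_ge0 //.
      by case: (_ != _); rewrite ?normr1 ?normr0 ?ler01.
    by rewrite ler_piMr ?exprn_ge0.
- move=> i j; set al := (U_(i) + U_(j))%MM.
  have al2 : mdeg al = 2 by rewrite mdegD !mdeg1.
  have al2' : (2 <= mdeg al)%N by rewrite al2.
  rewrite mxE -sE nuE; last exact: measurable_xpow.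
  rewrite -moment // -integralD //.
    apply: eq_integral => u _; rewrite w_xpow // -EFinD; congr EFin.
    (* In degree two no power of the radius remains: the indicators of [rt = 0] and [rt != 0] add up
       to [1]. *)
    rewrite al2 subnn expr0 !mul1r /T /thm prod_mnm1D.
    by case: eqP => _; rewrite /= ?mul0r ?mul1r ?addr0 ?add0r.
  apply: le_integrable (integrable_moment al2') => //.
    apply/measurable_EFinP; apply: measurable_funTS; apply: measurable_funM => //.
    by apply: measurableT_comp => //; exact: measurable_xpow.
  move=> u _; rewrite lee_fin w_xpow // normrM ler_piMl //.
  by case: (_ != _); rewrite ?normr1 ?normr0 ?ler01.
- move=> al al3; rewrite nuE; last exact: measurable_xpow.
  have al2 := ltnW al3.
  rewrite -moment //; apply: eq_integral => u _; rewrite w_xpow //.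
  (* From degree three on, a positive power of the radius vanishes at [rt = 0], which is why no
     matrix term appears. *)
  have [->|_] := eqVneq (rt u) 0; last by rewrite mul1r.
  by rewrite mul0r expr0n subn_eq0 leqNgt al3 mul0r.
Qed.

End LevyRepresentation.

Section Existence.
Local Open Scope classical_set_scope.
Context {R : realType} {n : nat}.
Implicit Types (c : 'X_{1..n} -> R) (al : 'X_{1..n}).

(** [lebesgue_measure] is carried by [measurableTypeR R]; its push-forward along the identity
    carries it over to [R]. *)
Lemma exists_length_measure : exists mu : {measure set R -> \bar R},
  forall x y : R, x <= y -> mu `[x, y[%classic = (y - x)%:E.
Proof.
have mid : measurable_fun setT (idfun : measurableTypeR R -> R).
  by move=> _ A mA; rewrite setTI.
exists (pushforward (@lebesgue_measure R) (idfun : measurableTypeR R -> R)) => x y xy.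
transitivity (lebesgue_measure (`[x, y[%classic : set (measurableTypeR R))); first by [].
rewrite lebesgue_measure_itv /= lte_fin EFinB.
by move: xy; rewrite le_eqVlt => /predU1P[->|->//]; rewrite ltxx subee.
Unshelve. exact: mid. Qed.

Lemma levy_representation c : conditionally_positive c -> exists (Sigma : 'M[R]_n)
    (nu : {measure set (n.-tuple R) -> \bar R}), psd_sym Sigma /\
  [/\ forall al, (2 <= mdeg al)%N ->
        (\int[nu]_(x in [set: n.-tuple R]) `|xpow al x|%:E < +oo)%E,
      forall i j, (c (U_(i) + U_(j))%MM)%:E
         = ((Sigma i j)%:E + \int[nu]_(x in [set: n.-tuple R]) (xpow (U_(i) + U_(j))%MM x)%:E)%E &
      forall al, (3 <= mdeg al)%N ->
        (c al)%:E = \int[nu]_(x in [set: n.-tuple R]) (xpow al x)%:E]%E.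
Proof.
move=> cp; have [mu mu_itv] := exists_length_measure.
have [M [Mlin Mpos Mlim Mclip]] := radial_functional cp.
have [G [Gc mG Gint Geq]] := positive_functional_coupling Mlin Mpos (@polar_cube R n) mu_itv.
apply: (@levy_representation_of_coupling _ _ c mu `[0, mass M[ G _ Gc mG
  (fun al => mom c (growth_poly (mdeg al).-1)) (fun k => mom c (growth_poly k))).
- exact: measurable_itv.
- by move=> K al K0; apply: Gint; apply: clip_monomial_lipschitz; exact: ltW.
- move=> K al K0 al2; exists (M (fun x => clip_monomial K al (polar x))).
  split; last exact: Mlim.
  by apply: Geq; apply: clip_monomial_lipschitz; exact: ltW.
- move=> K k K0; rewrite (Geq (fun z => clip K (z None) ^+ k)) ?lee_fin ?Mclip //.
  apply: cube_lipschitzX; apply: (@cube_lipschitz_coord _ _ (clip K) ((1 + K) ^+ 2)).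
    by rewrite exprn_ge0 // addr_ge0 // ltW.
  by move=> s t _ _; apply: clip_lipschitz; exact: ltW.
Qed.

Lemma measurable_outer_ball : measurable (outer_ball : set (n.-tuple R)).
Proof.
have ms : measurable_fun setT (fun x : n.-tuple R => \sum_(j < n) tnth x j ^+ 2).
  by apply: measurable_sum => j; apply: measurable_funX; exact: measurable_tnth.
rewrite (_ : outer_ball = setT `&` (fun x : n.-tuple R => \sum_(j < n) tnth x j ^+ 2) @^-1` `[1, +oo[).
  exact: ms (measurable_itv _).
by apply/seteqP; split => x /=; rewrite in_itv /= andbT //; case.
Qed.

(** Where [|x| >= 1], [|x_i|] is at most [|x_i| |x|^2], the sum over [j] of [|x_i x_j^2|], and third
    moments are finite. *)
Lemma integrable_outer_ball (nu : {measure set (n.-tuple R) -> \bar R}) i :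
  (forall al, (2 <= mdeg al)%N ->
     (\int[nu]_(x in [set: n.-tuple R]) `|xpow al x|%:E < +oo)%E) ->
  nu.-integrable outer_ball (fun x => (tnth x i)%:E).
Proof.
move=> nu_fin.
have mO := measurable_outer_ball.
have xpowD al be (x : n.-tuple R) : xpow (al + be)%MM x = xpow al x * xpow be x.
  by rewrite /xpow -big_split /=; apply: eq_bigr => k _; rewrite mnmDE exprD.
have xpowU j (x : n.-tuple R) : xpow U_(j)%MM x = tnth x j.
  rewrite /xpow (bigD1 j) //= mnm1E eqxx expr1 big1 ?mulr1 // => k /negbTE kj.
  by rewrite mnm1E eq_sym kj expr0.
apply: (@le_integrable _ _ _ nu outer_ball _ _
   (fun x => (\sum_(j < n) (`|xpow (U_(i) + (U_(j) + U_(j)))%MM x|%:E)%E)%E)) => //.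
- by apply/measurable_EFinP; apply: measurable_funTS; exact: measurable_tnth.
- move=> x ox; rewrite sumEFin lee_fin [leRHS]ger0_norm ?sumr_ge0 //.
  under eq_bigr do rewrite !xpowD !xpowU -expr2 normrM.
  rewrite -mulr_sumr -[leLHS]mulr1 ler_wpM2l //.
  apply: le_trans (ox : 1 <= _) _; apply: ler_sum => j _; exact: ler_norm.
- apply: integrable_sum => // j _.
  apply: (@integrableS _ _ _ nu setT) => //.
  apply/integrableP; split.
    apply/measurable_EFinP; apply: measurableT_comp => //; exact: measurable_xpow.
  under eq_integral do rewrite gee0_abs ?lee_fin //.
  by apply: nu_fin; rewrite !mdegD !mdeg1.
Qed.

End Existence.

Unset Implicit Arguments.

Theorem theorem5p12 (R : realType) (n : nat)
  (a : 'X_{1..n} -> {mpoly R[n]})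
  (ha : forall al : 'X_{1..n}, (msize (a al) <= (mdeg al).+1)%N) :
  (forall t : R, 0 <= t ->
     forall p : {mpoly R[n]}, Pos p -> Pos (expA a t p)) <->
  (forall y : 'I_n -> R,
     exists (Sigma : 'M[R]_n) (b : 'I_n -> R)
            (nu : {measure set (n.-tuple R) -> \bar R}),
       psd_sym Sigma /\
       [/\ 
           (forall i : 'I_n,
              (\int[nu]_(x in outer_ball) `|tnth x i|%:E < +oo)%E),
           (forall al : 'X_{1..n}, (2 <= mdeg al)%N ->
              (\int[nu]_(x in [set: n.-tuple R]) `|xpow al x|%:E < +oo)%E),
           (forall i : 'I_n,
              ((a (mnm1 i)).@[y])%:E
                = ((b i)%:E + \int[nu]_(x in outer_ball) (tnth x i)%:E)%E),
           (forall i j : 'I_n,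
              ((a (mnm_add (mnm1 i) (mnm1 j))).@[y])%:E
                = ((Sigma i j)%:E
                   + \int[nu]_(x in [set: n.-tuple R])
                        (xpow (mnm_add (mnm1 i) (mnm1 j)) x)%:E)%E) &
           (forall al : 'X_{1..n}, (3 <= mdeg al)%N ->
              ((a al).@[y])%:E
                = (\int[nu]_(x in [set: n.-tuple R]) (xpow al x)%:E)%E)]).
Proof.
split=> [pres y | levy t t0 p].
  have cp := preserver_conditionally_positive ha pres y.
  have [Sigma [nu [psdS [nu_fin h2 h3]]]] := levy_representation cp.
  (* No condition restricts [b], so it is whatever the first-order equation leaves. *)
  pose b i := (a U_(i)%MM).@[y] - fine (\int[nu]_(x in outer_ball) (tnth x i)%:E)%E.
  have io i := integrable_outer_ball i nu_fin.
  exists Sigma, b, nu; split=> //; split=> // i.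
    by have /integrableP[_] := io i; under eq_integral do rewrite abse_EFin.
  have <- : ((fine (\int[nu]_(x in outer_ball) (tnth x i)%:E))%:E
      = \int[nu]_(x in outer_ball) (tnth x i)%:E)%E.
    rewrite fineK //; apply: integrable_fin_num; last exact: io.
    exact: measurable_outer_ball.
  by rewrite /b -EFinD subrK.
apply: conditionally_positive_preserver => // y.
have [Sigma [b [nu [psdS [_ nu_fin _ h2 h3]]]]] := levy y.
exact: (levy_conditionally_positive nu_fin psdS h2 h3).
Qed.
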